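(* Let $X$ be $c_0$ or $l^q$ for some real $q\ge 1$, and let $p\in(0,1)$ with $p>1/2$. Let $W_p=(W_{i,j})_{i,j\ge 0}$ be the transition operator of the simple random walk on $\mathbb{Z}_+$, given by $W_{0,0}=1-p$, $W_{0,1}=p$, $W_{0,j}=0$ for $j\ge 2$, and, for $i\ge1$, $W_{i,i-1}=1-p$, $W_{i,i+1}=p$, and $W_{i,j}=0$ if $j\notin\{i-1,i+1\}$. Then $W_p$ is supercyclic on $X$. Moreover, for every $\lambda\in\mathbb{C}$ with $|\lambda|>\frac{1}{2p-1}$, the operator $\lambda W_p$ is frequently hypercyclic and Devaney chaotic on $X$.
   Context: $c_0$ is the space of complex sequences $(w_n)_{n\ge0}$ converging to $0$ with the supremum norm; $l^q$ is the space of complex sequences $(w_n)_{n\ge0}$ with $\|w\|_q=(\sum_{n\ge0}|w_n|^q)^{1/q}<\infty$. A matrix acts by $(Wx)_i=\sum_j W_{i,j}x_j$. For a bounded linear operator $T$ on a separable complex Banach space $X$: - $T$ is supercyclic if there is $x\in X$ with $\{\lambda T^n x : n\in\mathbb{N},\lambda\in\mathbb{C}\}$ dense in $X$. - $T$ is hypercyclic if there is $x\in X$ with dense orbit $\{T^nx:n\in\mathbb{N}\}$. - $T$ is frequently hypercyclic if there is $x\in X$ such that for every non-empty open $V\subset X$ the set $N(x,V)=\{k\in\mathbb{N}: T^kx\in V\}$ has positive lower density, i.e. $\liminf_{n\to\infty}\frac1n\,\mathrm{card}(N(x,V)\cap[1,n])>0$. - $T$ is Devaney chaotic if it is hypercyclic,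 has a dense set of periodic points, and has sensitive dependence on initial conditions: there is $\delta>0$ such that for every $x\in X$ and every neighborhood $U$ of $x$ there are $y\in U$ and an integer $n>0$ with $\|T^nx-T^ny\|\ge\delta$. *)

(* Defs.v *)
From HB Require Import structures.
From mathcomp Require Import all_boot all_order all_algebra.
From mathcomp Require Import all_classical all_reals all_analysis.
From mathcomp Require Import complex.

Set Implicit Arguments.
Unset Strict Implicit.
Unset Printing Implicit Defensive.

Import Order.TTheory GRing.Theory Num.Theory.
Import numFieldNormedType.Exports.

Local Open Scope classical_set_scope.
Local Open Scope ring_scope.
Local Open Scope complex_scope.

(* [normc z : R] is the modulus of [z : R[i]] as a real number; the norm `|z|
   of MathComp is its image [(normc z)%:C] in R[i].  The type of scalars R[i]
   carries its usual topology under the name R[i]^o. *)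
Notation normc := Normc.normc.

Section SequenceSpaces.
Variable R : realType.
Implicit Types (u v w : nat -> R[i]) (a : R[i]).

Inductive seq_space : Type :=
| C0
| Lq (q : R) of 1 <= q.

Definition xnorm (E : seq_space) w : \bar R :=
  match E with
  | C0 => ereal_sup (range (fun n => (normc (w n))%:E))
  | Lq q _ => ((\sum_(0 <= n <oo) (normc (w n) `^ q)%:E) `^ q^-1)%E
  end.

Definition in_space (E : seq_space) w : Prop :=
  match E with
  | C0 => (w : nat -> R[i]^o) @ \oo --> (0 : R[i]^o)
  | Lq _ _ => (xnorm E w < +oo)%E
  end.

Definition space_pred (E : seq_space) : {pred nat -> R[i]} :=
  fun w => `[< in_space E w >].

Record seqs_in (E : seq_space) : Type := Space {
  coords :> nat -> R[i];
  coordsP : coords \in space_pred E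
}.

Lemma in_spaceP E w : reflect (in_space E w) (w \in space_pred E).
Proof. exact: asboolP. Qed.

Lemma normc_ge0 a : 0 <= normc a.
Proof. by case: a => x y; exact: sqrtr_ge0. Qed.

Lemma normcC a : (normc a)%:C = `|a|.
Proof. by case: a. Qed.

Lemma xnorm_ge0 E w : (0 <= xnorm E w)%E.
Proof.
case: E => [|q q1] /=; last exact: poweR_ge0.
apply: (@le_trans _ _ (normc (w 0%N))%:E); first by rewrite lee_fin normc_ge0.
by apply: ereal_sup_ubound; exists 0%N.
Qed.

Lemma xnorm_Lnorm q (q1 : 1 <= q) w :
  xnorm (Lq q1) w = Lnorm (@counting _ R) q%:E (EFin \o (fun n => normc (w n))).
Proof.
rewrite Lnorm_counting ?(lt_le_trans ltr01)//=; congr (_ `^ _)%E.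
by apply: eq_eseriesr => n _ /=; rewrite ger0_norm ?normc_ge0.
Qed.

Lemma xnormD E u v : (xnorm E (u + v)%R <= xnorm E u + xnorm E v)%E.
Proof.
case: E => [|q q1] /=.
  apply: ge_ereal_sup => _ [n _ <-] /=.
  apply: (@le_trans _ _ ((normc (u n))%:E + (normc (v n))%:E)%E).
    by rewrite -EFinD lee_fin le_normcD.
  by apply: leeD; apply: ereal_sup_ubound; exists n.
rewrite -!/(xnorm (Lq q1) _) [leRHS](_ : _ =
  (Lnorm (@counting _ R) q%:E (EFin \o (fun n => normc (u n))) +
   Lnorm (@counting _ R) q%:E (EFin \o (fun n => normc (v n))))%E); last first.
  by rewrite -!xnorm_Lnorm.
apply: le_trans (minkowski_EFin _ _ _ q1) => //.
rewrite Lnorm_counting ?(lt_le_trans ltr01)//=.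
apply: gt0_ler_poweR.
- by rewrite invr_ge0 (le_trans ler01).
- by rewrite in_itv /= leey andbT nneseries_ge0// => n _ _;
    rewrite lee_fin powR_ge0.
- by rewrite in_itv /= leey andbT nneseries_ge0// => n _ _;
    rewrite lee_fin powR_ge0.
apply: lee_nneseries => [n _|n _]; first by rewrite lee_fin powR_ge0.
rewrite lee_fin ge0_ler_powR ?(le_trans ler01)// ?nnegrE ?normc_ge0//.
by rewrite ger0_norm ?addr_ge0 ?normc_ge0// le_normcD.
Qed.

Lemma xnormZ E a u : xnorm E (a *: u) = ((normc a)%:E * xnorm E u)%E.
Proof.
case: E => [|q q1] /=.
  rewrite -ereal_supZl ?normc_ge0//; last first.
    by apply/set0P; exists (normc (u 0%N))%:E; exists 0%N.
  congr ereal_sup; apply/seteqP; split => [_ [n _ <-]|_ [_ [n _ <-] <-]] /=.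
    by exists (normc (u n))%:E; [exists n|rewrite -EFinM -Normc.normcM].
  by exists n => //; rewrite -EFinM -Normc.normcM.
have q0 : 0 < q by rewrite (lt_le_trans ltr01).
under eq_eseriesr do rewrite /= Normc.normcM powRM ?normc_ge0// EFinM.
rewrite nneseriesZl; last by move=> n _; rewrite lee_fin powR_ge0.
rewrite poweRM ?lee_fin ?powR_ge0//; last first.
  by apply: nneseries_ge0 => n _ _; rewrite lee_fin powR_ge0.
by rewrite poweR_EFin -powRrM mulfV ?gt_eqF// powRr1 ?normc_ge0.
Qed.

Lemma xnorm_coord E w n : ((normc (w n))%:E <= xnorm E w)%E.
Proof.
case: E => [|q q1] /=; first by apply: ereal_sup_ubound; exists n.
have q0 : 0 < q by rewrite (lt_le_trans ltr01).
rewrite (_ : normc (w n) = (normc (w n) `^ q) `^ q^-1); last first.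
  by rewrite -powRrM mulfV ?gt_eqF// powRr1 ?normc_ge0.
rewrite -poweR_EFin; apply: gt0_ler_poweR.
- by rewrite invr_ge0 ltW.
- by rewrite in_itv /= leey andbT lee_fin powR_ge0.
- by rewrite in_itv /= leey andbT nneseries_ge0// => k _ _;
    rewrite lee_fin powR_ge0.
apply: le_trans (nneseries_lim_ge n.+1 _).
  rewrite big_nat_recr//= leeDr// sume_ge0// => k _.
  by rewrite lee_fin powR_ge0.
by move=> k _ _; rewrite lee_fin powR_ge0.
Qed.

Lemma xnorm_fin E w : in_space E w -> xnorm E w \is a fin_num.
Proof.
case: E => [|q q1] Ew; last by rewrite ge0_fin_numE ?xnorm_ge0.
have [M [Mreal wM]] : bounded_fun (w : nat -> R[i]^o).
  by apply: cvg_seq_bounded; apply/cvg_ex; exists 0.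
have {}wM n : normc (w n) <= complex.Re (M + 1).
  have : `|w n| <= M + 1 by apply: wM => //; rewrite ltrDl.
  by rewrite -normcC lecE => /andP[].
rewrite ge0_fin_numE ?xnorm_ge0//.
apply: (@le_lt_trans _ _ (complex.Re (M + 1))%:E); last exact: ltry.
by apply: ge_ereal_sup => _ [n _ <-]; rewrite lee_fin.
Qed.

Lemma space_submod_closed E : submod_closed (space_pred E).
Proof.
split.
  apply/in_spaceP; case: E => [|q q1] /=; first exact: cvg_cst.
  have q0 : 0 < q by rewrite (lt_le_trans ltr01).
  rewrite eseries0 ?poweR0r ?invr_neq0 ?gt_eqF// => n _ _.
  congr (_%:E); rewrite -[RHS](@powR0 _ q) ?gt_eqF//.
  by congr (_ `^ _); exact: Normc.normc0.
move=> a u v /in_spaceP Eu /in_spaceP Ev; apply/in_spaceP.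
case: E Eu Ev => [|q q1] Eu Ev.
  have := @cvgD _ R[i]^o _ _ _ _ _ _ _
    (@cvgZl_tmp _ R[i]^o _ _ _ a _ _ Eu) Ev.
  rewrite scaler0 addr0; exact.
apply: le_lt_trans (xnormD (Lq q1) _ _) _; rewrite xnormZ.
rewrite lte_add_pinfty//.
by rewrite -(fineK (xnorm_fin Eu)) -EFinM ltry.
Qed.

End SequenceSpaces.

Section NormedSpace.
Variables (R : realType) (E : seq_space R).

HB.instance Definition _ := GRing.isSubmodClosed.Build R[i] (nat -> R[i])
  (space_pred E) (@space_submod_closed R E).
HB.instance Definition _ := [isSub for @coords R E].
HB.instance Definition _ := [Choice of seqs_in E by <:].
HB.instance Definition _ := [SubChoice_isSubLmodule of seqs_in E by <:].

Definition space_norm (x : seqs_in E) : R[i] := (fine (xnorm E x))%:C.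

Let xnorm_finE (x : seqs_in E) : (fine (xnorm E x))%:E = xnorm E x.
Proof. by rewrite fineK// xnorm_fin//; apply/in_spaceP/coordsP. Qed.

Let space_normD (x y : seqs_in E) :
  space_norm (x + y) <= space_norm x + space_norm y.
Proof.
rewrite /space_norm -rmorphD lecR -lee_fin EFinD !xnorm_finE.
exact: xnormD.
Qed.

Let space_normZ (a : R[i]) (x : seqs_in E) :
  space_norm (a *: x) = `|a| * space_norm x.
Proof.
rewrite /space_norm -normcC -rmorphM; congr (_%:C); apply: EFin_inj.
by rewrite EFinM !xnorm_finE -xnormZ.
Qed.

Let space_norm_eq0 (x : seqs_in E) : space_norm x = 0 -> x = 0.
Proof.
move=> [x0]; apply: val_inj; apply/funext => n /=.
apply: Normc.eq0_normc; apply/eqP; rewrite eq_le normc_ge0 andbT -lee_fin.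
by rewrite (le_trans (xnorm_coord E _ _))// -xnorm_finE x0.
Qed.

HB.instance Definition _ := @Lmodule_isNormed.Build R[i] (seqs_in E)
  space_norm space_normD space_normZ space_norm_eq0.

Lemma space_normE (x : seqs_in E) : `|x| = (fine (xnorm E x))%:C.
Proof. by []. Qed.

End NormedSpace.

Section Dynamics.
Variables (R : realType) (X : normedModType R[i]).
Implicit Types (T : X -> X) (x y : X).

Definition bounded_operator T : Prop :=
  exists M : R, forall x, `|T x| <= M%:C * `|x|.

Definition supercyclic T : Prop :=
  exists x, dense [set y | exists (a : R[i]) (n : nat), y = a *: iter n T x].

Definition hypercyclic T : Prop :=
  exists x, dense [set iter n T x | n in [set: nat]].

Definition lower_density (A : set nat) : \bar R :=
  limn_einf (fun n : nat =>
    ((\sum_(1 <= k < n.+1) (k \in A))%N%:R / n%:R : R)%:E).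

Definition frequently_hypercyclic T : Prop :=
  exists x, forall V : set X, V !=set0 -> open V ->
    (0 < lower_density [set k | V (iter k T x)])%E.

Definition periodic_points T : set X :=
  [set x | exists n : nat, (0 < n)%N /\ iter n T x = x].

Definition sensitive T : Prop :=
  exists delta : R, 0 < delta /\
    forall x (U : set X), nbhs x U ->
      exists y (n : nat),
        [/\ U y, (0 < n)%N & delta%:C <= `|iter n T x - iter n T y|].

Definition devaney_chaotic T : Prop :=
  [/\ hypercyclic T, dense (periodic_points T) & sensitive T].

End Dynamics.

Definition walk_matrix (R : realType) (p : R) (i j : nat) : R :=
  if i is k.+1 then
    if j == k then 1 - p else if j == k.+2 then p else 0
  else
    if j == 0%N then 1 - p else if j == 1%N then p else 0.

(* [T] is the operator x |-> W x, (W x)_i = \sum_j W_{i,j} x_j; as the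
   coordinates determine a point of [seqs_in E], there is at most one such T. *)
Definition acts_as_matrix (R : realType) (E : seq_space R)
    (T : seqs_in E -> seqs_in E) (W : nat -> nat -> R) : Prop :=
  forall (x : seqs_in E) (i : nat),
    (series (fun j => (W i j)%:C * x j) : nat -> R[i]^o) @ \oo
      --> (T x i : R[i]^o).

(* Main.v *)
(* Let r = (1 - p) / p < 1, let F be the forward shift and
   S = p^-1 F (1 + r F^2)^-1.  Then W S = 1 and ||S|| <= 1 / (2p - 1), so that
   lambda^-1 S is a strictly contracting right inverse of T = lambda W as soon
   as |lambda| > 1 / (2p - 1).  If moreover the vectors killed by a power of T
   are dense, then T is frequently hypercyclic (sum suitably spaced
   (lambda^-1 S)^n y), its periodic points are dense (sum
   (lambda^-1 S)^(jn) y over j), and it is sensitive.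

   Density of G = U_n ker W^n.  In the language of generating functions,
   the eigenvectors of W with eigenvalue 2 p t x, where t = sqrt r and
   -1 <= x <= 1, are (1 - r X) / (1 - 2 t x X + t^2 X^2).  The one with x = 0
   lies in G, and the resolvent identity propagates membership in the closure
   of G from x to all close x', uniformly on [-1, 1].  For x = Re z, |z| = 1,
   the coefficients of (z - z^-1) / (1 - 2 t x X + t^2 X^2) are
   t^n (z^(n+1) - z^-(n+1)); averaging over dyadic roots of unity z isolates
   each monomial, whence the closure of G contains the range of 1 - r F, which
   is everything. *)
From HB Require Import structures.
Require Import Defs.
From mathcomp Require Import all_boot all_order all_algebra.
From mathcomp Require Import all_classical all_reals all_analysis.
From mathcomp Require Import complex.
From mathcomp Require Import zify ring lra.

Import Order.TTheory GRing.Theory Num.Theory.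
Import numFieldNormedType.Exports.

Local Open Scope classical_set_scope.
Local Open Scope ring_scope.
Local Open Scope complex_scope.

Set Implicit Arguments.
Unset Strict Implicit.
Unset Printing Implicit Defensive.

(** * Real-valued norms and bounded operators *)

Section RealNorm.
Variables (R : realType) (X : normedModType R[i]).
Implicit Types (x y z : X) (a : R[i]).

Definition rnorm x : R := complex.Re `|x|.

Lemma rnormE x : (rnorm x)%:C = `|x|.
Proof.
apply/eqP; rewrite eq_complex /= eqxx /= eq_sym.
by have := normr_ge0 x; rewrite lecE => /andP[].
Qed.

Lemma rnorm_ge0 x : 0 <= rnorm x.
Proof. by have := normr_ge0 x; rewrite lecE => /andP[]. Qed.

Lemma rnorm0 : rnorm 0 = 0.
Proof. by rewrite /rnorm normr0. Qed.

Lemma rnormD x y : rnorm (x + y) <= rnorm x + rnorm y.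
Proof. by have := ler_normD x y; rewrite -!rnormE -rmorphD lecE => /andP[]. Qed.

Lemma rnormZ a x : rnorm (a *: x) = normc a * rnorm x.
Proof. by rewrite /rnorm normrZ -normcC -rnormE -rmorphM. Qed.

Lemma rnormN x : rnorm (- x) = rnorm x.
Proof. by rewrite /rnorm normrN. Qed.

Lemma rnormB x y : rnorm (x - y) <= rnorm x + rnorm y.
Proof. by rewrite -(rnormN y) rnormD. Qed.

Lemma rdistC x y : rnorm (x - y) = rnorm (y - x).
Proof. by rewrite /rnorm distrC. Qed.

Lemma rdist_triangle z x y : rnorm (x - y) <= rnorm (x - z) + rnorm (z - y).
Proof. by rewrite -[x - y](subrKA z) rnormD. Qed.

Lemma rnorm_eq0 x : rnorm x = 0 -> x = 0.
Proof. by move=> x0; apply/normr0_eq0; rewrite -rnormE x0. Qed.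

Lemma rnorm_sum (I : Type) (r : seq I) (P : pred I) (F : I -> X) :
  rnorm (\sum_(i <- r | P i) F i) <= \sum_(i <- r | P i) rnorm (F i).
Proof.
elim/big_ind2: _ => [|u x v y ux vy|//]; first by rewrite rnorm0.
by rewrite (le_trans (rnormD _ _))// lerD.
Qed.

Lemma nbhs_rnorm x (U : set X) : nbhs x U ->
  exists2 e : R, 0 < e & forall y, rnorm (x - y) < e -> U y.
Proof.
move=> /nbhs_ballP[e /= e0 eU]; exists (complex.Re e).
  by move: e0; rewrite ltcE => /andP[].
move=> y xy; apply: eU; rewrite -ball_normE /ball_ /=.
by move: e0; rewrite -rnormE !ltcE /= => /andP[/eqP->] _; rewrite eqxx.
Qed.

Lemma rnorm_dense (A : set X) :
  (forall x (e : R), 0 < e -> exists2 y, A y & rnorm (x - y) < e) -> dense A.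
Proof.
move=> Ad U [x Ux] oU.
have [e e0 eU] := nbhs_rnorm (open_nbhs_nbhs (conj oU Ux)).
by have [y Ay xy] := Ad x e e0; exists y; split=> //; exact: eU.
Qed.

Definition rbounded (sigma : R) (T : X -> X) :=
  forall x, rnorm (T x) <= sigma * rnorm x.

Lemma rbounded_iter sigma (T : X -> X) n : 0 <= sigma -> rbounded sigma T ->
  rbounded (sigma ^+ n) (iter n T).
Proof.
move=> s0 sT x; elim: n => [|n IH]; first by rewrite expr0 mul1r.
by rewrite iterS exprS -mulrA (le_trans (sT _))// ler_wpM2l.
Qed.

End RealNorm.

(** Completeness enters the argument only through series dominated by a geometric one; the explicit
    tail bound identifies [s] as the sum and supplies the error estimates. *)
Definition geometric_complete (R : realType) (X : normedModType R[i]) :=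
  forall (u : nat -> X) (C sigma : R), 0 <= sigma < 1 ->
    (forall k, rnorm (u k) <= C * sigma ^+ k) ->
  exists s, forall n,
    rnorm (s - \sum_(k < n) u k) <= C * sigma ^+ n / (1 - sigma).

(** * Geometric decay *)

Section Scalars.
Variable R : realType.
Implicit Types sigma e : R.

Lemma exprn_lt_eps sigma e : 0 <= sigma < 1 -> 0 < e ->
  exists N, forall n, (N <= n)%N -> sigma ^+ n < e.
Proof.
move=> /andP[s0 s1] e0; have := @cvg_expr R sigma.
rewrite ger0_norm// => /(_ s1) /cvgrPdist_lt /(_ e e0)[N _ HN].
exists N => n /HN /=; rewrite sub0r normrN ger0_norm ?exprn_ge0//.
Qed.

Lemma exprn_mul_lt_eps sigma e (C : R) : 0 <= sigma < 1 -> 0 < e ->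
  exists N, forall n, (N <= n)%N -> C * sigma ^+ n < e.
Proof.
move=> s01 e0; have [||N HN] := @exprn_lt_eps sigma (e / (`|C| + 1)) => //.
  by rewrite divr_gt0// ltr_wpDl.
exists N => n /HN; rewrite ltr_pdivlMr ?ltr_wpDl//; apply: le_lt_trans.
rewrite mulrC ler_wpM2l ?exprn_ge0//; first by case/andP: s01.
by rewrite (le_trans (ler_norm C))// lerDl.
Qed.

Lemma geometric_sum_le sigma n : 0 <= sigma < 1 ->
  \sum_(k < n) sigma ^+ k <= (1 - sigma)^-1.
Proof.
move=> /andP[s0 s1]; have d0 : 0 < 1 - sigma by rewrite subr_gt0.
rewrite -[leRHS]mul1r ler_pdivlMr// mulrC -opprB mulNr -subrX1 opprB.
by rewrite gerBl exprn_ge0.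
Qed.

Lemma le_of_lt_eps (a b : R) : (forall e, 0 < e -> a < b + e) -> a <= b.
Proof. by move=> ab; apply/ler_addgt0Pr => e /ab /ltW. Qed.
End Scalars.

(** * Lower density *)

Section LowerDensity.
Variable R : realType.

(** The values [f i] with [i < n %/ c] are distinct elements of [A] in [[1, n]]. *)
Lemma lower_density_gt0 (A : set nat) (f : nat -> nat) (c : nat) :
  injective f -> (forall i, A (f i)) -> (forall i, 0 < f i <= c * i.+1)%N ->
  (0 < lower_density R A)%E.
Proof.
move=> f_inj Af fc; have c0 : (0 < c)%N by have := fc 0%N; lia.
have countA n : (n %/ c <= \sum_(1 <= k < n.+1) (k \in A))%N.
  rewrite (_ : (\sum_(1 <= k < n.+1) _)%N =
      size [seq k <- index_iota 1 n.+1 | k \in A]); last first.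
    by rewrite size_filter -sum1_count [RHS]big_mkcond.
  rewrite -[leqLHS](size_iota 0) -(size_map f); apply: uniq_leq_size.
    by rewrite map_inj_uniq ?iota_uniq.
  move=> _ /mapP[i + ->]; rewrite mem_iota add0n => /andP[_ ilt].
  rewrite mem_filter mem_index_iota ltnS mem_set//=.
  have := fc i; have : (c * i.+1 <= n)%N; last lia.
  by rewrite (leq_trans _ (leq_divM n c))// mulnC leq_mul2r ilt orbT.
(* Rounding [n / c] down loses at most a factor 2 once [c <= n]. *)
have e0 : 0 < ((2 * c)%:R : R)^-1 by rewrite invr_gt0 ltr0n muln_gt0.
apply: (@lt_le_trans _ _ ((2 * c)%:R^-1)%:E); first by rewrite lte_fin.
rewrite /lower_density limn_einf_lim.
apply: lime_ge; first exact: is_cvg_einfs.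
exists c => // m /= cm; apply: le_ereal_inf_tmp => _ [n /= mn <-].
have n0 : (0 < n)%N by lia.
rewrite lee_fin ler_pdivlMr ?ltr0n// mulrC ler_pdivrMr ?ltr0n ?muln_gt0//.
rewrite -natrM ler_nat; apply: leq_trans (leq_mul (countA n) (leqnn _)).
have := ltn_ceil n c0; have : (0 < n %/ c)%N by rewrite divn_gt0//; lia.
nia.
Qed.

Lemma lower_density_ex (A : set nat) : (0 < lower_density R A)%E ->
  exists k, A k.
Proof.
apply: contraPP => /forallNP A0; apply/negP; rewrite -leNgt.
rewrite /lower_density (_ : (fun _ => _) = (fun=> 0%E)); last first.
  apply/funext => n; rewrite big1 ?mul0r// => k _.
  by rewrite memNset.
by have [-> _] := cvg_limn_einf_sup (cvg_cst (0 : \bar R)%E (F := \oo)).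
Qed.

End LowerDensity.

(* Times indexed so that those of index [j] with [logn 2 j = v], a set of
   positive density, are at distance at least [v] from all the others; they
   grow linearly because [logn 2] is bounded on average. *)
Section RulerTimes.
Local Open Scope nat_scope.

Definition ruler_gap (j : nat) : nat := (logn 2 j).+1.

(** Intervals of radius [ruler_gap j] are laid end to end from 0; this is the centre of the [j]-th
    one. *)
Definition ruler_time (j : nat) : nat :=
  \sum_(i < j) 2 * ruler_gap i + ruler_gap j.

(** The slack [j - i.+1], one unit for each interval in between, later makes the sum of the errors
    geometric. *)
Lemma ruler_time_gap i j : i < j ->
  ruler_time i + ruler_gap i + ruler_gap j + (j - i.+1) <= ruler_time j.
Proof.
rewrite /ruler_time; elim: j => // j IH; rewrite ltnS leq_eqVlt.
case/predU1P => [->|/IH]; rewrite big_ord_recr /=; first lia.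
by have : 0 < ruler_gap j by []; lia.
Qed.

(** The sum is the 2-adic valuation of [n!], which Legendre's formula writes as a sum of
    [n %/ 2 ^ k]. *)
Lemma sum_logn2_le n : \sum_(1 <= i < n.+1) logn 2 i <= n.
Proof.
have -> : \sum_(1 <= i < n.+1) logn 2 i = logn 2 n`!.
  elim: n => [|n IH]; first by rewrite big_geq// logn1.
  by rewrite big_nat_recr//= IH factS lognM ?fact_gt0// addnC.
rewrite logn_fact//.
(* The extra term [n %/ 2 ^ K] makes the bound inductive, since twice [n %/ 2 ^ K.+1] is at most
   [n %/ 2 ^ K]. *)
have H K : \sum_(1 <= k < K.+1) n %/ 2 ^ k + n %/ 2 ^ K <= n.
  elim: K => [|K IH]; first by rewrite big_geq// expn0 divn1.
  rewrite big_nat_recr//= (leq_trans _ IH)// -addnA leq_add2l.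
  by rewrite expnSr divnMA addnn -muln2 leq_divM.
by rewrite (leq_trans _ (H n))// leq_addr.
Qed.

Lemma ruler_time_le j : ruler_time j <= 4 * j.+1.
Proof.
have H : \sum_(i < j.+1) ruler_gap i <= 2 * j.+1.
  under eq_bigr do rewrite /ruler_gap -addn1.
  rewrite big_split /= sum1_card card_ord big_ord_recl logn0 add0n.
  have := sum_logn2_le j; rewrite big_add1 big_mkord /=.
  rewrite (eq_bigr (fun i : 'I_j => logn 2 (lift ord0 i)))// => /leq_trans.
  move=> H; rewrite mulSn mul1n leq_add2r. by apply: H; lia.
move: H; rewrite /ruler_time -big_distrr big_ord_recr /=; lia.
Qed.

Lemma ruler_time_inj : injective ruler_time.
Proof.
move=> i j; have : 0 < ruler_gap i /\ 0 < ruler_gap j by [].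
by case: (ltngtP i j) => // /ruler_time_gap; lia.
Qed.

End RulerTimes.

(** * Operators with a contracting right inverse *)

Lemma logn2_odd_mul v i : logn 2 (2 ^ v * (2 * i).+1) = v.
Proof.
rewrite lognM ?expn_gt0// pfactorK// logn_coprime ?addn0// coprime2n /=.
by rewrite oddM.
Qed.

(** In [sigma ^+ ruler_time j], an exponent [logn 2 j] absorbs the norm of the label, and an
    exponent [j] remains for convergence. *)
Lemma ruler_time_ge j : (j + logn 2 j <= ruler_time j)%N.
Proof.
rewrite /ruler_time leq_add//.
elim: j => // j IH; rewrite big_ord_recr /= -addn1 leq_add//.
Qed.

Section IterLinear.
Variables (K : pzRingType) (X : lmodType K) (T : {linear X -> X}).

Lemma iter_linear_is_linear n : linear (iter n T).
Proof. by move=> a x y; elim: n => //= n ->; rewrite linearP. Qed.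

HB.instance Definition _ n :=
  GRing.isLinear.Build K X X *:%R (iter n T) (iter_linear_is_linear n).

End IterLinear.

Lemma iter_cancel (X : Type) (S T : X -> X) m n x : cancel S T ->
  iter m T (iter (m + n) S x) = iter n S x.
Proof.
move=> ST; elim: m => [//|m IH] in x *.
by rewrite iterSr addSn iterS ST IH.
Qed.

Lemma iterK (X : Type) (S T : X -> X) n x : cancel S T ->
  iter n T (iter n S x) = x.
Proof. by move=> ST; rewrite -[in iter n S x](addn0 n) iter_cancel. Qed.

Section RightInverse.
Variables (R : realType) (X : normedModType R[i]).
Variables (T S : {linear X -> X}) (M sigma : R) (y : nat -> X).
Hypotheses (complX : geometric_complete X) (M0 : 0 <= M)
  (sigma01 : 0 <= sigma < 1).
Hypotheses (TM : rbounded M T) (Ssigma : rbounded sigma S) (ST : cancel S T).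
Hypothesis y_dense : forall x (e : R), 0 < e -> exists k, rnorm (x - y k) < e.
Hypothesis y_nil : forall k, exists d, iter d T (y k) = 0.

Let sigma0 : 0 <= sigma. Proof. by case/andP: sigma01. Qed.
Let sigma1 : 0 < 1 - sigma. Proof. by rewrite subr_gt0; case/andP: sigma01. Qed.
Let sigma_le1 : sigma <= 1. Proof. by rewrite -subr_ge0 ltW. Qed.

Lemma iter_nil_ge d n x : (d <= n)%N -> iter d T x = 0 -> iter n T x = 0.
Proof. by move=> /subnK <- Tx; rewrite iterD Tx linear0. Qed.

(* Each [y k] reappears as [z v] for infinitely many [v], so that the single
   index [v] can bound the nilpotency order, the size and the spacing. *)
Lemma nilpotent_labels : exists z : nat -> X,
  (forall v, iter v T (z v) = 0 /\ sigma ^+ v * rnorm (z v) <= 1) /\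
  (forall x (e : R) N, 0 < e -> exists2 v, (N <= v)%N & rnorm (x - z v) < e).
Proof.
pose good v k := `[< iter v T (y k) = 0 /\ sigma ^+ v * rnorm (y k) <= 1 >].
(* An inadmissible candidate is replaced by 0, which meets both requirements. *)
exists (fun v => if good v (logn 2 v) then y (logn 2 v) else 0); split=> [v|].
  case: ifP => [/asboolP//|_]; split; last by rewrite rnorm0 mulr0.
  exact: linear0.
move=> x e N e0; have [k xk] := y_dense x e0; have [d yd] := y_nil k.
have [N' HN'] := exprn_mul_lt_eps (rnorm (y k)) sigma01 ltr01.
(* [v] has valuation [k], so its candidate is [y k]; the odd factor makes it at least [N], [d] and
   [N']. *)
pose a := (N + d + N')%N; pose v := (2 ^ k * (2 * a).+1)%N.
have av : (a <= v)%N.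
  by rewrite (@leq_trans (2 * a).+1)//; [lia|rewrite leq_pmull ?expn_gt0].
exists v; first by lia.
rewrite /v logn2_odd_mul -/v ifT//; apply/asboolP; split.
  by apply: iter_nil_ge yd; lia.
by rewrite mulrC ltW// HN'//; lia.
Qed.

(** At time [ruler_time i], the terms before [i] have died by nilpotency, term [i] has become its
    label, and the later terms still carry high powers of [S]. *)
Lemma iter_ruler_series (z : nat -> X) s :
  (forall v, iter v T (z v) = 0 /\ sigma ^+ v * rnorm (z v) <= 1) ->
  (forall n, rnorm (s - \sum_(k < n) iter (ruler_time k) S (z (logn 2 k)))
     <= sigma ^+ n / (1 - sigma)) ->
  forall i, rnorm (iter (ruler_time i) T s - z (logn 2 i)) <=
    sigma ^+ ruler_gap i / (1 - sigma).
Proof.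
move=> zP sP i; apply: le_of_lt_eps => e e0; set m := ruler_time i.
(* [iter m T] may expand a tail by [M ^+ m]; as [m] is fixed, cutting the series at a large [L]
   makes this error less than [e]. *)
have [N HN] := exprn_mul_lt_eps (M ^+ m / (1 - sigma)) sigma01 e0.
pose L := (i.+1 + N)%N; set u := fun k => iter (ruler_time k) S (z (logn 2 k)).
have -> : iter m T s - z (logn 2 i) = iter m T (s - \sum_(k < L) u k) +
    \sum_(i.+1 <= k < L) iter (ruler_time k - m) S (z (logn 2 k)).
  rewrite linearB -addrA; congr (_ + _).
  rewrite linear_sum /= -(big_mkord xpredT (fun k => iter m T (u k))).
  rewrite (@big_cat_nat _ _ _ i.+1)//=; last by rewrite leq_addr.
  rewrite big_nat_recr//= big_nat big1 ?add0r; last first.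
    move=> k /andP[_ ki]; have := ruler_time_gap ki; rewrite -/m => km.
    rewrite (_ : m = (m - ruler_time k) + ruler_time k)%N; last by lia.
    rewrite iterD /u iterK//.
    have [/= zk _] := zP (logn 2 k); apply: iter_nil_ge zk.
    by rewrite /ruler_gap in km; lia.
  rewrite {1}/u iterK// [X in _ = _ + X](eq_big_nat _ _
    (F2 := fun k => iter m T (u k))); first by rewrite opprD subrK.
  move=> k /andP[ik _]; have := ruler_time_gap ik => km.
  rewrite /u -[in RHS](@subnKC m (ruler_time k)) ?iter_cancel//.
  by rewrite -/m in km; lia.
apply: le_lt_trans (rnormD _ _) _; rewrite addrC; apply: ler_ltD; last first.
  apply: le_lt_trans (rbounded_iter m M0 TM _) _.
  apply: le_lt_trans (ler_wpM2l (exprn_ge0 m M0) (sP L)) _.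
  by rewrite mulrCA mulrC HN// /L; lia.
rewrite (le_trans (rnorm_sum _ _ _))//.
apply: (@le_trans _ _ (\sum_(i.+1 <= k < L)
   sigma ^+ ruler_gap i * sigma ^+ (k - i.+1))).
  apply: ler_sum_nat => k /andP[ik _]; have := ruler_time_gap ik => km.
  rewrite (le_trans (rbounded_iter _ _ Ssigma _))//.
  have [_ zk] := zP (logn 2 k).
  (* An exponent [logn 2 k] pays for the label; the gap property leaves at least
     [ruler_gap i + (k - i.+1)]. *)
  rewrite (_ : ruler_time k - m = (ruler_time k - m - logn 2 k) + logn 2 k)%N.
    rewrite exprD -mulrA (le_trans (ler_wpM2l _ zk)) ?exprn_ge0// mulr1 -exprD.
    rewrite ler_wiXn2l//. 
    by rewrite /ruler_gap in km *; lia.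
  by rewrite /ruler_gap in km *; lia.
rewrite -mulr_sumr ler_wpM2l ?exprn_ge0//.
rewrite -{1}[i.+1]add0n big_addn big_mkord.
under eq_bigr do rewrite addnK.
exact: geometric_sum_le.
Qed.

(** A label [z v] close to the target is approached, with error [sigma ^+ v.+1 / (1 - sigma)], at
    every time whose index has valuation [v]; taking [v] large makes the error small. *)
Lemma frequently_hypercyclic_of_right_inverse : frequently_hypercyclic T.
Proof.
have [z [zP zd]] := nilpotent_labels.
pose u k := iter (ruler_time k) S (z (logn 2 k)).
have [k|s sP] := @complX u 1 sigma sigma01.
  rewrite mul1r (le_trans (rbounded_iter _ _ Ssigma _))//.
  rewrite -(subnK (ruler_time_ge k)) addnA exprD -mulrA.
  rewrite (le_trans (ler_wpM2l _ (proj2 (zP _)))) ?exprn_ge0// mulr1.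
  by rewrite ler_wiXn2l// leq_addl.
exists s => V [x Vx] oV.
have [e e0 eV] := nbhs_rnorm (open_nbhs_nbhs (conj oV Vx)).
have e2 : 0 < e / 2 by rewrite divr_gt0.
have [N HN] := exprn_mul_lt_eps (1 - sigma)^-1 sigma01 e2.
have [v Nv xv] := zd x (e / 2) N e2.
(* For the index [n = 2 ^ v * (2 * i).+1], [ruler_time n <= 4 * n.+1] and
   [n.+1 <= 2 * 2 ^ v * i.+1]. *)
pose c := (8 * 2 ^ v)%N; have := expn_gt0 2 v => /= c0.
apply: (@lower_density_gt0 _ _ (fun i => ruler_time (2 ^ v * (2 * i).+1)) c).
- move=> i j /ruler_time_inj /eqP; rewrite eqn_mul2l; lia.
- move=> i; apply: eV; set n := (2 ^ v * _)%N.
  have nv : logn 2 n = v by exact: logn2_odd_mul.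
  have := @iter_ruler_series z s zP _ n; rewrite nv => H.
  rewrite (le_lt_trans (rdist_triangle (z v) _ _))// [ltRHS]splitr ltrD//.
  rewrite rdistC (le_lt_trans (H _))//; last first.
    by rewrite mulrC /ruler_gap nv HN//; lia.
  by move=> k; rewrite (le_trans (sP k))// mul1r.
- move=> i; apply/andP; split; first by rewrite /ruler_time addn_gt0 orbT.
  by apply: leq_trans (ruler_time_le _) _; rewrite /c; nia.
Qed.

Lemma hypercyclic_of_right_inverse : hypercyclic T.
Proof.
have [x xP] := frequently_hypercyclic_of_right_inverse; exists x => V V0 oV.
have [k Vk] := lower_density_ex (xP V V0 oV).
by exists (iter k T x); split=> //; exists k.
Qed.

(** When [T^n y = 0], the sum of the [S^(jn) y] is fixed by [T^n]; for [n] large it is close to its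
    first term [y]. *)
Lemma periodic_dense_of_right_inverse : dense (periodic_points T).
Proof.
apply: rnorm_dense => x e e0.
have e2 : 0 < e / 2 by rewrite divr_gt0.
have [k xk] := y_dense x e2; have [d yd] := y_nil k.
have [N HN] := exprn_mul_lt_eps (rnorm (y k) / (1 - sigma)) sigma01 e2.
have [n [dn Nn n0]] : exists n, [/\ (d <= n)%N, (N <= n)%N & (0 < n)%N].
  by exists (d + N).+1; split; lia.
pose u j := iter (j * n) S (y k).
set q := sigma ^+ n.
have q0 : 0 <= q by exact: exprn_ge0.
have q_le : q <= sigma by rewrite -[leRHS]expr1 ler_wiXn2l.
have q1 : 0 < 1 - q by rewrite (lt_le_trans sigma1)// lerB.
have q01 : 0 <= q < 1 by rewrite q0 -subr_gt0.
have [j|s sP] := @complX u (rnorm (y k)) q q01.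
  by rewrite (le_trans (rbounded_iter _ sigma0 Ssigma _))// mulrC mulnC exprM.
exists s; last first.
  rewrite (le_lt_trans (rdist_triangle (y k) _ _))// [ltRHS]splitr ltrD//.
  have := sP 1%N; rewrite big_ord1 /u mul0n expr1 rdistC /= => /le_lt_trans.
  apply; apply: le_lt_trans (HN n Nn).
  rewrite -/q -mulrA [leRHS]mulrAC -mulrA ler_wpM2l ?rnorm_ge0// ler_wpM2l//.
  by rewrite lef_pV2 ?posrE// lerB.
exists n; split=> //; apply/eqP; rewrite -subr_eq0; apply/eqP/rnorm_eq0/eqP.
rewrite eq_le rnorm_ge0 andbT; apply: le_of_lt_eps => e' e'0; rewrite add0r.
have [L HL] := exprn_mul_lt_eps ((M ^+ n + 1) * (rnorm (y k) / (1 - q))) q01 e'0.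
(* [T^n] carries the partial sum of length [L.+1] to that of length [L], so only two tails
   remain. *)
have -> : iter n T s - s = iter n T (s - \sum_(j < L.+1) u j) -
    (s - \sum_(j < L) u j).
  rewrite linearB big_ord_recl linearD {1}/u mul0n /= (iter_nil_ge dn yd).
    rewrite add0r linear_sum /= (eq_bigr (fun j : 'I_L => u j)).
    by rewrite opprB addrA subrK.
  by move=> j _; rewrite /u mulSn iter_cancel.
apply: le_lt_trans (HL L (leqnn L)); apply: le_trans (rnormB _ _) _.
rewrite mulrDl mul1r mulrDl lerD//; last by rewrite mulrAC.
apply: le_trans (rbounded_iter n M0 TM _) _.
rewrite -[leRHS]mulrA ler_wpM2l ?exprn_ge0// (le_trans (sP _))// mulrAC.
rewrite ler_wpM2l ?mulr_ge0 ?rnorm_ge0 ?invr_ge0 ?(ltW q1)//.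
by rewrite ler_wiXn2l// (le_trans q_le).
Qed.

(** The perturbation [S^(N+1) x0] is as small as desired, yet [T^(N+1)] returns it to [x0]. *)
Lemma sensitive_of_right_inverse (x0 : X) : x0 != 0 -> sensitive T.
Proof.
move=> x00; exists (rnorm x0); split.
  rewrite lt_neqAle rnorm_ge0 andbT; apply: contra x00 => /eqP/esym.
  by move/rnorm_eq0 ->.
move=> x U /nbhs_rnorm[e e0 eU].
have [N HN] := exprn_mul_lt_eps (rnorm x0) sigma01 e0.
exists (x - iter N.+1 S x0), N.+1; split=> //.
  apply: eU; rewrite opprB addrC subrK.
  by rewrite (le_lt_trans (rbounded_iter _ _ Ssigma _))// mulrC HN.
rewrite linearB /= opprB addrC subrK rnormE.
by have /= -> := iterK N.+1 x0 ST.
Qed.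

End RightInverse.

(** * The spaces c_0 and l^q *)

Section SequenceSpaceTheory.
Variables (R : realType).
Implicit Types (E : seq_space R) (w u v : nat -> R[i]) (C e : R).

Definition trunc N w : nat -> R[i] := fun n => if (n < N)%N then w n else 0.
Definition shift w : nat -> R[i] := fun n => if n is k.+1 then w k else 0.
Definition backshift w : nat -> R[i] := fun n => w n.+1.
Definition delta k : nat -> R[i] := fun n => (n == k)%:R.

Lemma normc_complexR (x : R) : normc x%:C = `|x|.
Proof. by apply: complexI; rewrite normcC normc_def expr0n addr0 sqrtr_sqr. Qed.

Lemma xnorm0 E : xnorm E 0 = 0%E.
Proof. by rewrite -(scale0r 0) xnormZ Normc.normc0 mul0e. Qed.

(** Reduces estimates of the [l^q] norm to finite sums of reals. *)
Lemma xnorm_Lq_le (q : R) (q1 : 1 <= q) w C : 0 <= C ->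
  (xnorm (Lq q1) w <= C%:E)%E <->
  forall N, \sum_(n < N) normc (w n) `^ q <= C `^ q.
Proof.
move=> C0; have q0 : 0 < q by rewrite (lt_le_trans ltr01).
have pos n : (0 <= (normc (w n) `^ q)%:E)%E by rewrite lee_fin powR_ge0.
have S0 : (0 <= \sum_(0 <= n <oo) (normc (w n) `^ q)%:E)%E.
  by rewrite nneseries_ge0.
have qq x : 0 <= x -> (x `^ q) `^ q^-1 = x :> R.
  by move=> x0; rewrite -powRrM mulfV ?gt_eqF// powRr1.
split=> [wC N|wC] /=.
  rewrite -lee_fin -sumEFin.
  rewrite -(big_mkord xpredT (fun n => (normc (w n) `^ q)%:E)).
  apply: le_trans (nneseries_lim_ge N _) _; first by move=> *; exact: pos.
  rewrite -[leLHS]poweRe1// -(mulVf (lt0r_neq0 q0)) poweRrM -poweR_EFin.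
  apply: gt0_ler_poweR => //; first exact: ltW.
    by rewrite in_itv /= leey andbT poweR_ge0.
  by rewrite in_itv /= leey andbT lee_fin.
rewrite -[C]qq// -poweR_EFin; apply: gt0_ler_poweR.
- by rewrite invr_ge0 ltW.
- by rewrite in_itv /= leey andbT.
- by rewrite in_itv /= leey andbT lee_fin powR_ge0.
apply: lime_le; first by apply: is_cvg_nneseries.
by apply: nearW => N; rewrite big_mkord sumEFin lee_fin.
Qed.

Lemma xnorm_C0_le w C :
  (xnorm (@C0 R) w <= C%:E)%E <-> forall n, normc (w n) <= C.
Proof.
split=> [wC n|wC].
  by rewrite -lee_fin; apply: le_trans wC; exact: (xnorm_coord (@C0 R)).
by apply: ge_ereal_sup => _ [n _ <-]; rewrite lee_fin.
Qed.

Lemma xnorm_le_of E u v :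
  (forall C, 0 <= C -> (xnorm E v <= C%:E)%E -> (xnorm E u <= C%:E)%E) ->
  (xnorm E u <= xnorm E v)%E.
Proof.
move=> H; have := xnorm_ge0 E v; case Ev: (xnorm E v) => [C| |] C0//.
  by apply: H; rewrite ?Ev -?lee_fin.
by rewrite leey.
Qed.

Lemma xnorm_le E u v : (forall n, normc (u n) <= normc (v n)) ->
  (xnorm E u <= xnorm E v)%E.
Proof.
move=> uv; apply: xnorm_le_of => C C0; case: E => [|q q1].
  by rewrite !xnorm_C0_le => vC n; exact: le_trans (uv n) (vC n).
rewrite !xnorm_Lq_le// => vC N; apply: le_trans (vC N).
apply: ler_sum => n _; rewrite ge0_ler_powR ?nnegrE ?normc_ge0//.
by rewrite (le_trans ler01).
Qed.

(** A Fatou property, through which norm bounds pass to coordinatewise limits. *)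
Lemma xnorm_trunc_le E w C : 0 <= C ->
  (forall N, (xnorm E (trunc N w) <= C%:E)%E) -> (xnorm E w <= C%:E)%E.
Proof.
move=> C0 wC; case: E wC => [|q q1] wC.
  apply/xnorm_C0_le => n; have /xnorm_C0_le/(_ n) := wC n.+1.
  by rewrite /trunc ltnSn.
apply/xnorm_Lq_le => // N; have /(xnorm_Lq_le q1 _ C0)/(_ N) := wC N.
by congr (_ <= _); apply: eq_bigr => n _; rewrite /trunc ltn_ord.
Qed.

Lemma xnorm_shift E w : (xnorm E (shift w) <= xnorm E w)%E.
Proof.
apply: xnorm_le_of => C C0; case: E => [|q q1].
  rewrite !xnorm_C0_le => wC [|n]; last exact: wC.
  by rewrite /= expr0n addr0 sqrtr0.
rewrite !xnorm_Lq_le// => wC [|N]; first by rewrite big_ord0 powR_ge0.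
rewrite big_ord_recl (_ : normc (shift w _) = 0) ?powR0 ?add0r.
- exact: wC.
- by rewrite gt_eqF// (lt_le_trans ltr01).
- exact: Normc.normc0.
Qed.

Lemma xnorm_backshift E w : (xnorm E (backshift w) <= xnorm E w)%E.
Proof.
apply: xnorm_le_of => C C0; case: E => [|q q1].
  by rewrite !xnorm_C0_le => wC n; exact: wC.
rewrite !xnorm_Lq_le// => wC N; apply: le_trans (wC N.+1).
by rewrite big_ord_recl /= lerDr powR_ge0.
Qed.

Lemma xnorm_delta E k : (xnorm E (delta k) <= 1%:E)%E.
Proof.
case: E => [|q q1].
  apply/xnorm_C0_le => n; rewrite /delta.
  by case: eqP => _; rewrite ?Normc.normc1 ?Normc.normc0.
apply/xnorm_Lq_le => // N; rewrite powR1.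
have q0 : q != 0 by rewrite gt_eqF// (lt_le_trans ltr01).
have [kN|Nk] := ltnP k N.
  rewrite (bigD1 (Ordinal kN))//= big1 => [|n nk].
    by rewrite /delta eqxx Normc.normc1 powR1 addr0.
  rewrite /delta (_ : (_ == _) = false) ?Normc.normc0 ?powR0//.
  by apply: contraNF nk => /eqP nk; apply/eqP/val_inj.
rewrite big1 // => n _; rewrite /delta ltn_eqF ?Normc.normc0 ?powR0//.
exact: leq_trans Nk.
Qed.

Lemma truncS N w : trunc N.+1 w = trunc N w + w N *: delta N.
Proof.
apply/funext => n; rewrite /trunc /delta ltnS.
rewrite [RHS](_ : _ = (if (n < N)%N then w n else 0) + w N * (n == N)%:R)//.
by case: ltngtP => [||->]; rewrite ?mulr0 ?addr0// mulr1 add0r.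
Qed.

Lemma trunc0 w : trunc 0 w = 0.
Proof. by apply/funext. Qed.

Lemma xnorm_trunc_sum E N w :
  (xnorm E (trunc N w) <= (\sum_(n < N) normc (w n))%:E)%E.
Proof.
elim: N => [|N IH]; first by rewrite trunc0 xnorm0 big_ord0.
rewrite truncS big_ord_recr EFinD (le_trans (xnormD _ _ _))// leeD//.
rewrite xnormZ -[leRHS]mule1 lee_pmul ?lee_fin ?normc_ge0 ?xnorm_ge0//.
exact: xnorm_delta.
Qed.

(** This criterion hides the difference between [c_0] and [l^q]: the arguments after it treat both
    alike. For [l^q] it rests on the convergence of bounded increasing partial sums. *)
Lemma in_spaceE E w : in_space E w <->
  forall e, 0 < e -> exists N, (xnorm E (w - trunc N w)%R <= e%:E)%E.
Proof.
have tailE N n : (w - trunc N w) n = if (n < N)%N then 0 else w n.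
  rewrite [LHS](_ : _ = w n - trunc N w n)// /trunc.
  by case: ifP; rewrite ?subrr ?subr0.
case: E => [|q q1] /=; split.
- move=> /cvgrPdist_le w0 e e0.
  have [|N _ HN] := w0 e%:C; first by rewrite ltcR.
  exists N; apply/xnorm_C0_le => n; rewrite tailE; case: ltnP => [_|Nn].
    by rewrite Normc.normc0 ltW.
  by have := HN n Nn; rewrite /= sub0r normrN -normcC lecR.
- move=> w0; apply/cvgrPdist_le => e; rewrite ltcE => /andP[/eqP /= e_im e0].
  have [N /xnorm_C0_le wN] := w0 _ e0; exists N => // n /= Nn.
  rewrite sub0r normrN -normcC lecE /= -e_im eqxx /=.
  by have := wN n; rewrite tailE ltnNge Nn.
- move=> wfin e e0; have q0 : 0 < q by rewrite (lt_le_trans ltr01).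
  have wle : (xnorm (Lq q1) w <= (fine (xnorm (Lq q1) w))%:E)%E.
    by rewrite fineK ?xnorm_fin.
  set f := fun N => \sum_(n < N) normc (w n) `^ q.
  have fC N : f N <= fine (xnorm (Lq q1) w) `^ q.
    by move: wle; rewrite xnorm_Lq_le ?fine_ge0 ?xnorm_ge0//; apply.
  have f_incr : {homo f : m n / (m <= n)%N >-> m <= n}.
    apply/nondecreasing_seqP => n; rewrite /f big_ord_recr lerDl.
    exact: powR_ge0.
  have f_cvg : cvgn f.
    apply: nondecreasing_is_cvgn => //; eexists => _ [N _ <-].
    exact: fC.
  have eq0 : 0 < e `^ q by exact: powR_gt0.
  have [N _ HN] : \forall n \near \oo, `|limn f - f n| <= e `^ q.
    by move/cvgrPdist_le: f_cvg; apply.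
  exists N; apply/(xnorm_Lq_le q1 _ (ltW e0)).
  move=> L; apply: (le_trans _ (HN N (leqnn N))).
  apply: le_trans (ler_norm _); rewrite lerBrDr.
  apply: le_trans (nondecreasing_cvgn_le f_incr f_cvg (maxn N L)).
  elim: L => [|L IH]; first by rewrite big_ord0 add0r maxn0.
  rewrite big_ord_recr /= tailE; case: ltnP => LN.
    rewrite Normc.normc0 powR0 ?gt_eqF// addr0 (le_trans IH)//.
    by rewrite (maxn_idPl (ltnW LN)) (maxn_idPl LN).
  rewrite (maxn_idPr (leqW LN)) {2}/f big_ord_recr /= addrAC lerD2r.
  by rewrite (maxn_idPr LN) in IH.
(* A single approximation suffices here, because a truncation has finite norm. *)
- move=> /(_ 1 ltr01)[N wN]; have := xnormD (Lq q1) (w - trunc N w) (trunc N w).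
  rewrite subrK => /le_lt_trans; apply; rewrite lte_add_pinfty//.
    by apply: le_lt_trans wN _; exact: ltry.
  by apply: le_lt_trans (xnorm_trunc_sum _ _ _) _; exact: ltry.
Qed.

Lemma in_space_shift E w : in_space E w -> in_space E (shift w).
Proof.
move=> /in_spaceE wE; apply/in_spaceE => e /wE[N wN]; exists N.+1.
rewrite (_ : _ - _ = shift (w - trunc N w)).
  exact: le_trans (xnorm_shift _ _) wN.
apply/funext => -[|n]; first by rewrite /trunc [LHS]subrr.
by rewrite [LHS](_ : _ = shift w n.+1 - trunc N.+1 (shift w) n.+1).
Qed.

Lemma in_space_backshift E w : in_space E w -> in_space E (backshift w).
Proof.
move=> /in_spaceE wE; apply/in_spaceE => e /wE[N wN]; exists N.
apply: le_trans wN; apply: le_trans (xnorm_backshift E _).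
apply: xnorm_le => n.
rewrite (_ : (_ - _) n = backshift w n - trunc N (backshift w) n)//.
rewrite (_ : backshift (w - trunc N w) n = w n.+1 - trunc N w n.+1)//.
rewrite /trunc /backshift.
case: (ltnP n N) => nN; first by rewrite subrr Normc.normc0 normc_ge0.
by rewrite ltnNge (leqW nN) subr0.
Qed.

Lemma in_space_delta E k : in_space E (delta k).
Proof.
apply/in_spaceE => e e0; exists k.+1.
rewrite (_ : _ - _ = 0) ?xnorm0 ?lee_fin ?ltW//; apply/funext => n.
rewrite [LHS](_ : _ = delta k n - trunc k.+1 (delta k) n)// /trunc /delta.
by case: ltnP => [_|/gtn_eqF->]; rewrite subrr.
Qed.

Lemma in_space_closed E w :
  (forall e, 0 < e ->
    exists2 v, in_space E v & (xnorm E (w - v)%R <= e%:E)%E) ->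
  in_space E w.
Proof.
move=> wE; apply/in_spaceE => e e0; have e2 : 0 < e / 2 by rewrite divr_gt0.
have [v /in_spaceE/(_ _ e2)[N vN] wv] := wE _ e2; exists N.
rewrite [e]splitr EFinD.
have -> : w - trunc N w = ((w - v) - trunc N (w - v)) + (v - trunc N v).
  apply/funext => n; rewrite [LHS](_ : _ = w n - trunc N w n)//.
  rewrite [RHS](_ : _ = ((w n - v n) - trunc N (w - v) n) + (v n - trunc N v n))//.
  rewrite /trunc; case: ifP => _; last by rewrite !subr0 subrK.
  by rewrite [X in (X - _) + _](_ : _ = (w - v) n)// !subrr addr0.
apply: le_trans (xnormD E (w - v - trunc N (w - v)) (v - trunc N v)) _.
apply: leeD => //.
apply: le_trans wv; apply: xnorm_le => n.
rewrite (_ : (_ - trunc _ _) n = (w - v) n - trunc N (w - v) n)// /trunc.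
by case: ifP => _; rewrite ?subr0// subrr Normc.normc0 normc_ge0.
Qed.

End SequenceSpaceTheory.

(** * Scalar series and rational approximation *)

Section ScalarSeries.
Variable R : realType.

Lemma geometric_tail_le (C sigma : R) K L : 0 <= C -> 0 <= sigma < 1 ->
  \sum_(K <= k < L) C * sigma ^+ k <= C * sigma ^+ K / (1 - sigma).
Proof.
move=> C0 s01; have s0 : 0 <= sigma by case/andP: s01.
rewrite -[K in \sum_(K <= _ < _) _]add0n big_addn big_mkord.
under eq_bigr do rewrite addnC exprD mulrA.
by rewrite -mulr_sumr ler_wpM2l ?mulr_ge0 ?exprn_ge0 ?geometric_sum_le.
Qed.

Lemma real_geometric_complete (a : nat -> R) (C sigma : R) :
  0 <= sigma < 1 -> (forall k, `|a k| <= C * sigma ^+ k) ->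
  exists s, forall n, `|s - \sum_(k < n) a k| <= C * sigma ^+ n / (1 - sigma).
Proof.
move=> s01 aC; have [s0 s1] := andP s01.
have C0 : 0 <= C.
  by have := aC 0%N; rewrite expr0 mulr1; apply: le_trans.
have acvg : cvgn (series a).
  apply: normed_cvg; apply: (@series_le_cvg _ _ (geometric C sigma)).
  - by move=> n; exact: normr_ge0.
  - by move=> n; rewrite /= mulr_ge0// exprn_ge0.
  - by move=> n; exact: aC.
  - by apply: is_cvg_geometric_series; rewrite ger0_norm.
exists (limn (series a)) => n; apply: le_of_lt_eps => e e0.
have [N _ HN] : \forall n \near \oo, `|limn (series a) - series a n| < e.
  by move/cvgrPdist_lt: acvg; apply.
have nN : (n <= maxn n N)%N by exact: leq_maxl.
have := HN (maxn n N) (leq_maxr _ _); rewrite /= => HN'.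
rewrite -[X in `|X|](subrKA (series a (maxn n N))) addrC.
rewrite (le_lt_trans (ler_normD _ _))// ler_ltD//.
rewrite {1}/series /= -(big_mkord xpredT) (@big_cat_nat _ _ _ n)//= addrC addrK.
rewrite (le_trans (ler_norm_sum _ _ _))//.
by apply: le_trans (geometric_tail_le n (maxn n N) C0 s01); exact: ler_sum.
Qed.

Lemma normc_le_ReIm (z : R[i]) :
  normc z <= `|complex.Re z| + `|complex.Im z|.
Proof.
rewrite {1}[z]complexE; apply: le_trans (le_normcD _ _) _.
rewrite Normc.normcM normc_complexR normc_complexR lerD//.
by rewrite /= expr0n expr1n add0r sqrtr1 mul1r.
Qed.

Lemma Re_le_normc (z : R[i]) : `|complex.Re z| <= normc z.
Proof.
by case: z => a b /=; rewrite -sqrtr_sqr ler_wsqrtr// lerDl sqr_ge0.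
Qed.

Lemma Im_le_normc (z : R[i]) : `|complex.Im z| <= normc z.
Proof.
by case: z => a b /=; rewrite -sqrtr_sqr ler_wsqrtr// lerDr sqr_ge0.
Qed.

(** Real and imaginary parts are summed separately, whence the factor 2; it will only multiply a
    quantity made arbitrarily small. *)
Lemma complex_geometric_complete (a : nat -> R[i]) (C sigma : R) :
  0 <= sigma < 1 -> (forall k, normc (a k) <= C * sigma ^+ k) ->
  exists s, forall n,
    normc (s - \sum_(k < n) a k) <= C * sigma ^+ n / (1 - sigma) *+ 2.
Proof.
move=> s01 aC.
have [|s sP] := @real_geometric_complete (fun k => complex.Re (a k)) C sigma s01.
  by move=> k; apply: le_trans (aC k); exact: Re_le_normc.
have [|t tP] := @real_geometric_complete (fun k => complex.Im (a k)) C sigma s01.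
  by move=> k; apply: le_trans (aC k); exact: Im_le_normc.
exists (s +i* t) => n; apply: le_trans (normc_le_ReIm _) _.
have -> : \sum_(k < n) a k =
    (\sum_(k < n) complex.Re (a k)) +i* (\sum_(k < n) complex.Im (a k)).
  by apply/eqP; rewrite eq_complex /= !raddf_sum !eqxx.
by rewrite mulr2n; exact: lerD (sP n) (tP n).
Qed.

Lemma complex_rat_dense (z : R[i]) (e : R) : 0 < e ->
  exists c : rat * rat, normc (z - (ratr c.1 +i* ratr c.2)) <= e.
Proof.
move=> e0.
have H (x : R) : exists c : rat, `|x - ratr c| <= e / 2.
  have [|c] := @rat_in_itvoo _ (x - e / 2) (x + e / 2).
    by rewrite ltrD2l gt0_cp// divr_gt0.
  rewrite in_itv /= => /andP[c1 c2]; exists c.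
  by rewrite ler_norml; apply/andP; split; lra.
have [a aP] := H (complex.Re z); have [b bP] := H (complex.Im z).
exists (a, b); apply: le_trans (normc_le_ReIm _) _.
by rewrite [e]splitr !raddfB /= lerD.
Qed.

End ScalarSeries.

(** * Completeness, separability and shifts of the sequence spaces *)

Section SpaceTheory.
Variables (R : realType) (E : seq_space R).
Implicit Types (x y : seqs_in E).

Definition to_space (w : nat -> R[i]) (wE : in_space E w) : seqs_in E :=
  Defs.Space (introT (in_spaceP E w) wE).

Lemma in_space_coords x : in_space E x.
Proof. exact/in_spaceP/coordsP. Qed.

Lemma coordsI x y : (forall n, x n = y n) -> x = y.
Proof. by move=> xy; apply: val_inj; apply/funext. Qed.

Lemma coordD x y n : (x + y) n = x n + y n.
Proof. exact: (congr1 (@^~ n) (GRing.valD x y)). Qed.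

Lemma coordZ a x n : (a *: x) n = a * x n.
Proof. by []. Qed.

Lemma coords0 n : (0 : seqs_in E) n = 0.
Proof. by []. Qed.

Lemma coordN x n : (- x) n = - x n.
Proof. by []. Qed.

Lemma coordB x y n : (x - y) n = x n - y n.
Proof. by rewrite coordD coordN. Qed.

Lemma coord_sum (I : Type) (r : seq I) (P : pred I) (F : I -> seqs_in E) n :
  (\sum_(i <- r | P i) F i) n = \sum_(i <- r | P i) F i n.
Proof. by elim/big_rec2: _ => // i y1 y2 _ <-; rewrite coordD. Qed.

Lemma xnormE x : xnorm E x = (rnorm x)%:E.
Proof. by rewrite /rnorm space_normE /= fineK// xnorm_fin//; exact: in_space_coords. Qed.

Lemma normc_coord x n : normc (x n) <= rnorm x.
Proof. by rewrite -lee_fin -xnormE xnorm_coord. Qed.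

(** The sum is formed coordinatewise. On the first [N] coordinates it is compared with a partial sum
    [S M], [M] large: [S M - S K] obeys the desired bound and the [N] scalar remainders are
    negligible. Then [N] is arbitrary by the Fatou property. *)
Lemma space_geometric_complete : geometric_complete (seqs_in E).
Proof.
move=> u C sigma s01 uC; have [s0 s1] := andP s01.
have C0 : 0 <= C.
  by have := uC 0%N; rewrite expr0 mulr1; apply: le_trans; exact: rnorm_ge0.
have /choice[s sP] n : exists t, forall k,
    normc (t - \sum_(j < k) u j n) <= C * sigma ^+ k / (1 - sigma) *+ 2.
  apply: (@complex_geometric_complete _ (fun k => u k n) _ _ s01) => k.
  exact: le_trans (normc_coord _ _) (uC k).
pose S K : seqs_in E := \sum_(k < K) u k.
have tail K : (xnorm E (s - coords (S K))%R <= (C * sigma ^+ K / (1 - sigma))%:E)%E.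
  apply: xnorm_trunc_le => [|N].
    by apply: divr_ge0; [rewrite mulr_ge0 ?exprn_ge0|rewrite subr_ge0 ltW].
  apply/lee_addgt0Pr => e e0; rewrite -EFinD.
  have [L HL] := exprn_mul_lt_eps ((C / (1 - sigma) *+ 2) *+ N) s01 e0.
  pose M := maxn K L; have KM : (K <= M)%N by exact: leq_maxl.
  have -> : trunc N (s - coords (S K)) =
      trunc N (coords (S M - S K)) + trunc N (s - coords (S M)).
    apply/funext => n; rewrite [RHS](_ : _ = trunc N (coords (S M - S K)) n +
      trunc N (s - coords (S M)) n)// /trunc; case: ifP => _; rewrite ?addr0//.
    rewrite coordB [LHS](_ : _ = s n - S K n)//.
    by rewrite (_ : (s - coords (S M)) n = s n - S M n)// [RHS]addrC subrKA.
  apply: le_trans (xnormD E _ _) _; rewrite EFinD; apply: leeD.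
    apply: (@le_trans _ _ (xnorm E (S M - S K))).
      apply: xnorm_le => n; rewrite /trunc; case: ifP => // _.
      by rewrite Normc.normc0 normc_ge0.
    rewrite xnormE lee_fin /S -(big_mkord xpredT) (@big_cat_nat _ _ _ K)//=.
    rewrite big_mkord addrC addrK (le_trans (rnorm_sum _ _ _))//.
    by apply: le_trans (geometric_tail_le K M C0 s01); exact: ler_sum.
  apply: le_trans (xnorm_trunc_sum _ _ _) _; rewrite lee_fin.
  apply: (@le_trans _ _ (\sum_(n < N) (C / (1 - sigma) *+ 2 * sigma ^+ M))).
    apply: ler_sum => n _; rewrite [leRHS]mulrnAl [in leRHS]mulrAC.
    by rewrite (_ : (s - coords (S M)) n = s n - S M n)// coord_sum.
  by rewrite sumr_const card_ord -[leLHS]mulrnAl ltW// HL// leq_maxr.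
have sE : in_space E s.
  apply: in_space_closed => e e0.
  have [N HN] := exprn_mul_lt_eps (C / (1 - sigma)) s01 e0.
  exists (coords (S N)); first exact: in_space_coords.
  by apply: le_trans (tail N) _; rewrite lee_fin mulrAC ltW// HN.
by exists (to_space sE) => n; rewrite -lee_fin -xnormE; exact: tail.
Qed.

Definition rat_sequence (c : seq (rat * rat)) : nat -> R[i] :=
  fun n => ratr (nth (0, 0) c n).1 +i* ratr (nth (0, 0) c n).2.

Lemma in_space_rat_sequence c : in_space E (rat_sequence c).
Proof.
apply/in_spaceE => e e0; exists (size c).
rewrite (_ : _ - _ = 0) ?xnorm0 ?lee_fin ?ltW//; apply/funext => n.
rewrite [LHS](_ : _ = rat_sequence c n - trunc (size c) (rat_sequence c) n)//.
rewrite /trunc; case: ltnP => [_|cn]; first by rewrite subrr.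
by rewrite subr0 /rat_sequence nth_default//= rmorph0.
Qed.

Lemma space_separable : exists d : nat -> seqs_in E,
  forall x (e : R), 0 < e -> exists k, rnorm (x - d k) < e.
Proof.
pose dec k := odflt [::] (unpickle k : option (seq (rat * rat))).
exists (fun k => to_space (in_space_rat_sequence (dec k))) => x e e0.
have /in_spaceE/(_ (e / 3))[|N xN] := in_space_coords x; first by rewrite divr_gt0.
(* [N] errors of size [t] add up to strictly less than [e / 2], also when [N = 0]. *)
pose t := e / 2 / N.+1%:R; have t0 : 0 < t by rewrite !divr_gt0.
have /choice[c cP] n := complex_rat_dense (x n) t0.
exists (pickle (mkseq c N)); set d := to_space _.
have dE n : d n = if (n < N)%N then ratr (c n).1 +i* ratr (c n).2 else 0.
  rewrite /d /= /dec pickleK /= /rat_sequence; case: ltnP => nN.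
    by rewrite nth_mkseq.
  by rewrite nth_default ?size_mkseq// rmorph0.
rewrite -lte_fin -xnormE [e]splitr EFinD.
have -> : coords (x - d) = (coords x - trunc N (coords x)) + trunc N (coords (x - d)).
  apply/funext => n; rewrite [RHS](_ : _ = x n - trunc N (coords x) n +
    trunc N (coords (x - d)) n)// /trunc coordB dE.
  by case: ifP => _; rewrite ?addr0// subrr add0r.
have := xnormD E (coords x - trunc N (coords x)) (trunc N (coords (x - d))).
move=> /le_lt_trans; apply; apply: lteD.
  by apply: le_lt_trans xN _; rewrite lte_fin; lra.
apply: le_lt_trans (xnorm_trunc_sum _ _ _) _; rewrite lte_fin.
apply: (@le_lt_trans _ _ (\sum_(n < N) t)).
  by apply: ler_sum => n _; rewrite coordB dE ltn_ord.
rewrite sumr_const card_ord -[ltLHS]mulr_natr /t [ltLHS]mulrAC ltr_pdivrMr ?ltr0n//.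
by rewrite ltr_pM2l ?divr_gt0// ltr_nat.
Qed.

Definition shift_space x : seqs_in E := to_space (in_space_shift (in_space_coords x)).
Definition backshift_space x : seqs_in E :=
  to_space (in_space_backshift (in_space_coords x)).
Definition delta_space k : seqs_in E := to_space (in_space_delta E k).

Lemma shift_space_is_linear : linear shift_space.
Proof.
move=> a x y; apply: coordsI => -[|n]; rewrite [RHS]coordD; last exact: coordD.
by rewrite coordZ [RHS]addr0 [RHS]mulr0.
Qed.

Lemma backshift_space_is_linear : linear backshift_space.
Proof.
by move=> a x y; apply: coordsI => n; rewrite [RHS]coordD; exact: coordD.
Qed.

HB.instance Definition _ := GRing.isLinear.Build R[i] (seqs_in E) (seqs_in E)
  *:%R shift_space shift_space_is_linear.
HB.instance Definition _ := GRing.isLinear.Build R[i] (seqs_in E) (seqs_in E)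
  *:%R backshift_space backshift_space_is_linear.

Lemma shift_space_bounded : rbounded 1 shift_space.
Proof. by move=> x; rewrite mul1r -lee_fin -!xnormE xnorm_shift. Qed.

Lemma backshift_space_bounded : rbounded 1 backshift_space.
Proof. by move=> x; rewrite mul1r -lee_fin -!xnormE xnorm_backshift. Qed.

Lemma rnorm_delta_space k : rnorm (delta_space k) <= 1.
Proof. by rewrite -lee_fin -xnormE xnorm_delta. Qed.

End SpaceTheory.

(** * Quadratic polynomials in a contraction *)

Section BoundedBelow.
Variables (R : realType) (X : normedModType R[i]).
Hypothesis complX : geometric_complete X.

Lemma neumann (L : {linear X -> X}) sigma x : 0 <= sigma < 1 ->
  rbounded sigma L -> exists y, y - L y = x.
Proof.
move=> s01 Ls; have [s0 s1] := andP s01.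
have [k|s sP] := @complX (fun k => iter k L x) (rnorm x) sigma s01.
  by rewrite mulrC; exact: rbounded_iter.
exists s; apply/eqP; rewrite -subr_eq0; apply/eqP/rnorm_eq0/eqP.
rewrite eq_le rnorm_ge0 andbT; apply: le_of_lt_eps => e e0; rewrite add0r.
have [N HN] := exprn_mul_lt_eps (rnorm x / (1 - sigma) *+ 2) s01 e0.
apply: le_lt_trans (HN N (leqnn N)).
pose S n := \sum_(k < n) iter k L x.
(* Since [S N.+1 = x + L (S N)], the residual consists of two tails. *)
have -> : s - L s - x = (s - S N.+1) - L (s - S N).
  rewrite linearB /S big_ord_recl /= linear_sum /= opprB opprD.
  by rewrite -!addrA addKr [- L s - x]addrC.
rewrite (le_trans (rnormB _ _))// [leRHS]mulrnAl mulr2n lerD//.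
  rewrite (le_trans (sP _))// [leRHS]mulrAC ler_wpM2r ?invr_ge0 ?subr_ge0 ?(ltW s1)//.
  by rewrite ler_wpM2l ?rnorm_ge0// ler_wiXn2l// ltW.
rewrite (le_trans (Ls _))// -[leRHS]mul1r.
rewrite ler_pM ?rnorm_ge0 ?(ltW s1)//.
by rewrite (le_trans (sP _))// mulrAC.
Qed.

(** Choice gives a section of [P]; the lower bound makes [P] injective, so the section is linear,
    and bounds its norm. *)
Lemma bounded_below_inverse (P : {linear X -> X}) (c : R) : 0 < c ->
  (forall x, c * rnorm x <= rnorm (P x)) -> (forall x, exists y, P y = x) ->
  exists A : {linear X -> X}, [/\ cancel A P, cancel P A & rbounded c^-1 A].
Proof.
move=> c0 Pc /choice[A AK].
have P_inj : injective P.
  move=> x y Pxy; apply/eqP; rewrite -subr_eq0; apply/eqP/rnorm_eq0/eqP.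
  rewrite eq_le rnorm_ge0 andbT -(ler_pM2l c0) mulr0.
  by rewrite (le_trans (Pc _))// linearB Pxy subrr rnorm0.
have A_lin : linear A by move=> a x y; apply: P_inj; rewrite linearP !AK.
pose A' : {linear X -> X} := HB.pack A (GRing.isLinear.Build _ _ _ _ A A_lin).
exists A'; split=> [//|x|x]; first by apply: P_inj; exact: AK.
by rewrite ler_pdivlMl// -[in leRHS](AK x) Pc.
Qed.

Variable F : {linear X -> X}.
Hypothesis F1 : rbounded 1 F.

(** One family contains [1 + r F^2], [1 - r F] and the Chebyshev operators below. *)
Definition quad_op (a b : R[i]) (x : X) : X := x - a *: F x + b *: F (F x).

Lemma quad_op_is_linear a b : linear (quad_op a b).
Proof.
move=> c x y; rewrite /quad_op !linearP !scalerDr.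
by rewrite [X in X + _ = _]addrACA [LHS]addrACA.
Qed.

HB.instance Definition _ a b := GRing.isLinear.Build R[i] X X *:%R
  (quad_op a b) (quad_op_is_linear a b).

Lemma quad_opC a b x : quad_op a b (F x) = F (quad_op a b x).
Proof. by rewrite /quad_op linearD linearB !linearZ. Qed.

Lemma one_sub_bounded_below a x :
  (1 - normc a) * rnorm x <= rnorm (x - a *: F x).
Proof.
rewrite mulrBl mul1r lerBlDr -{1}[x](subrK (a *: F x)).
apply: le_trans (rnormD _ _) _; rewrite lerD2l rnormZ ler_wpM2l ?normc_ge0//.
by have := F1 x; rewrite mul1r.
Qed.

Lemma one_sub_surj a y : normc a < 1 -> exists x, x - a *: F x = y.
Proof.
move=> a1; apply: (@neumann (a \*: F) (normc a)); first by rewrite normc_ge0.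
move=> x; rewrite /= rnormZ ler_wpM2l ?normc_ge0//.
by have := F1 x; rewrite mul1r.
Qed.

Lemma quad_op_factor s s' x :
  quad_op (s + s') (s * s') x = (x - s' *: F x) - s *: F (x - s' *: F x).
Proof.
have -> : F (x - s' *: F x) = F x - s' *: F (F x) by rewrite linearB linearZ.
rewrite /quad_op scalerBr scalerA scalerDl !opprD opprK !addrA.
by congr (_ + _); exact: addrAC.
Qed.

(** Each factor [1 - s F] is onto and bounded below by [1 - rho]. *)
Lemma quad_inverse s s' (rho : R) : rho < 1 ->
  normc s <= rho -> normc s' <= rho ->
  exists A : {linear X -> X}, [/\ cancel A (quad_op (s + s') (s * s')),
    cancel (quad_op (s + s') (s * s')) A & rbounded ((1 - rho) ^+ 2)^-1 A].
Proof.
move=> rho1 sr s'r; apply: bounded_below_inverse => [|x|x].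
- by rewrite exprn_gt0// subr_gt0.
- rewrite /= quad_op_factor; apply: le_trans (one_sub_bounded_below s _).
  rewrite expr2 -mulrA ler_pM ?mulr_ge0 ?rnorm_ge0 ?subr_ge0 ?(ltW rho1)//.
    by rewrite lerB.
  apply: le_trans (one_sub_bounded_below s' _).
  by rewrite ler_wpM2r ?rnorm_ge0// lerB.
- have [y yx] := one_sub_surj x (le_lt_trans sr rho1).
  have [z zy] := one_sub_surj y (le_lt_trans s'r rho1).
  by exists z; rewrite /= quad_op_factor zy.
Qed.

Lemma inverse_commute (P A : {linear X -> X}) :
  (forall x, P (F x) = F (P x)) -> cancel A P -> cancel P A ->
  forall x, A (F x) = F (A x).
Proof. by move=> PF AK PK x; rewrite -{1}[x]AK -PF PK. Qed.

Definition closed_subspace (Y : X -> Prop) : Prop :=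
  [/\ Y 0, forall a x y, Y x -> Y y -> Y (a *: x + y) &
    forall x, (forall e : R, 0 < e -> exists2 y, Y y & rnorm (x - y) < e) ->
      Y x].

Section Invariance.
Variable Y : X -> Prop.
Hypothesis Ycl : closed_subspace Y.

(** [z - K^n z] is the sum of the [K^k y] over [k < n], hence in [Y], and [K^n z] tends to 0. *)
Lemma closed_subspace_fixpoint (K : {linear X -> X}) sigma y z :
  0 <= sigma < 1 -> rbounded sigma K -> (forall x, Y x -> Y (K x)) ->
  Y y -> z = y + K z -> Y z.
Proof.
move=> s01 Ks KY Yy zE; have [s0 _] := andP s01; have [Y0 YD Yc] := Ycl.
apply: Yc => e e0; have [N HN] := exprn_mul_lt_eps (rnorm z) s01 e0.
have Yn n : Y (z - iter n K z).
  elim: n => [|n IH]; first by rewrite subrr.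
  rewrite /= {1}zE -addrA -linearB -[y]scale1r; apply: YD => //.
  exact: KY.
exists (z - iter N K z) => //; rewrite opprB addrC subrK.
by rewrite (le_lt_trans (rbounded_iter N s0 Ks z))// mulrC HN.
Qed.

Variables (t : R) (v : X).
Hypothesis t01 : 0 < t < 1.

(* [1 - 2 t x F + t^2 F^2], whose inverse generates the Chebyshev polynomials
   of the second kind; with [x = cos theta] and [s = t e^(i theta)] it is
   [(1 - s F)(1 - s^* F)], hence invertible uniformly in [x]. *)
Definition cheb_op (x : R) := quad_op (t * x *+ 2)%:C (t ^+ 2)%:C.
(** For [|x| <= 1], with [A] the inverse of [cheb_op x]: [Y] is stable under [F A] and contains
    [A v]. The form chosen does not mention the inverse. *)
Definition invariant_at (x : R) : Prop :=
  (forall y, Y (cheb_op x y) -> Y (F y)) /\ (forall y, cheb_op x y = v -> Y y).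

Lemma cheb_op_inverse x : -1 <= x <= 1 -> exists A : {linear X -> X},
  [/\ cancel A (cheb_op x), cancel (cheb_op x) A & rbounded ((1 - t) ^+ 2)^-1 A].
Proof.
move=> x1; have [t0 t1] := andP t01.
have x2 : 0 <= 1 - x ^+ 2 by nra.
pose w := Num.sqrt (1 - x ^+ 2).
have w2 : w ^+ 2 = 1 - x ^+ 2 by rewrite sqr_sqrtr.
have -> : cheb_op x = quad_op ((t * x) +i* (t * w) + (t * x) +i* (- (t * w)))
    (((t * x) +i* (t * w)) * ((t * x) +i* (- (t * w)))).
  rewrite /cheb_op; congr quad_op; apply/eqP; rewrite eq_complex /=.
    by rewrite mulr2n subrr !eqxx.
  by apply/andP; split; apply/eqP; [nra|ring].
have H (y : R) : y ^+ 2 = w ^+ 2 -> normc ((t * x) +i* (t * y)) <= t.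
  move=> y2 /=; rewrite !exprMn -mulrDr y2 w2 addrC subrK mulr1 sqrtr_sqr.
  by rewrite ger0_norm// ltW.
apply: quad_inverse => //; first exact: H.
by rewrite -mulrN H// sqrrN.
Qed.

(* Resolvent identity: [A_x' = A_x + d F A_x A_x'] where [A_x] is the inverse
   of [cheb_op x] and [d = 2 t (x' - x)]. *)
Lemma invariant_step x x' : -1 <= x <= 1 ->
  `|x' - x| * t *+ 4 <= (1 - t) ^+ 2 -> invariant_at x -> invariant_at x'.
Proof.
move=> x1 xx' [IF Iv]; have [t0 t1] := andP t01.
have [A [AK PK Ab]] := cheb_op_inverse x1.
pose d := t * (x' - x) *+ 2.
have PE y : cheb_op x y = cheb_op x' y + d%:C *: F y.
  rewrite /cheb_op /quad_op /d [RHS]addrAC; congr (_ + _); rewrite -addrA; congr (_ + _).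
  rewrite -!scaleNr -scalerDl; congr (_ *: _); rewrite -!rmorphN -rmorphD /=.
  by congr (_%:C); ring.
have AF y : A (F y) = F (A y).
  apply: (@inverse_commute (quad_op (t * x *+ 2)%:C (t ^+ 2)%:C) A _ AK PK).
  exact: quad_opC.
pose K : {linear X -> X} := d%:C \*: (F \o A).
(* The permitted distance from [x] to [x'] is exactly what makes [|d| / (1 - t)^2] at most
   [1 / 2]. *)
have Kb : rbounded (2^-1) K.
  move=> y; rewrite /= rnormZ normc_complexR.
  have := Ab y; have := F1 (A y); rewrite mul1r => FA /(le_trans FA).
  have c0 : 0 < (1 - t) ^+ 2 by rewrite exprn_gt0// subr_gt0.
  move=> /(ler_wpM2l (normr_ge0 d)) /le_trans; apply.
  rewrite mulrA ler_wpM2r ?rnorm_ge0// ler_pdivrMr//.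
  move: xx'; rewrite /d normrMn normrM (gtr0_norm t0); lra.
have half : 0 <= (2^-1 : R) < 1 by lra.
have KY y : Y y -> Y (K y).
  have [Y0 YD _] := Ycl.
  move=> Yy; rewrite /= -[_ *: _]addr0; apply: YD => //; apply: IF.
  by rewrite AK.
have ZD (G : {linear X -> X}) c u w : G u + c *: G w = G (u + c *: w).
  by rewrite linearD linearZ.
split=> y Py.
  (* Applying [F A] to [PE] gives [F y = F A (cheb_op x' y) + K (F y)]. *)
  apply: (closed_subspace_fixpoint half Kb KY (y := F (A (cheb_op x' y)))).
    by apply: IF; rewrite AK.
  by rewrite [K _]/= !ZD -PE PK.
(* Likewise [y = A v + K y], as [A] commutes with [F]. *)
apply: (closed_subspace_fixpoint half Kb KY (y := A v)).
  by apply: Iv; rewrite AK.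
by rewrite [K _]/= -AF ZD -Py -PE PK.
Qed.

(** The admissible step length does not depend on the point, so finitely many equal steps lead from
    0 to [x]. *)
Lemma invariant_chain : invariant_at 0 ->
  forall x, -1 <= x <= 1 -> invariant_at x.
Proof.
move=> I0 x x1; have [t0 t1] := andP t01.
have c0 : 0 < (1 - t) ^+ 2 by rewrite exprn_gt0// subr_gt0.
(* Steps have length at most [1 / n], and [4 t / n <= (1 - t)^2] for this [n]. *)
pose n := (Num.truncn (4 / (1 - t) ^+ 2)).+1.
have nP : 4 / (1 - t) ^+ 2 < n%:R :> R by exact: truncnS_gt.
have n0 : 0 < n%:R :> R by rewrite ltr0n.
have xn k : (k <= n)%N -> -1 <= x * (k%:R / n%:R) <= 1.
  move=> kn; set q : R := k%:R / n%:R.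
  have : 0 <= q <= 1 by rewrite divr_ge0//= ler_pdivrMr// mul1r ler_nat.
  have [x_ge x_le] := andP x1; move=> /andP[q0 q1].
  by apply/andP; split; nra.
suff H k : (k <= n)%N -> invariant_at (x * (k%:R / n%:R)).
  by have := H n (leqnn n); rewrite divff ?mulr1 ?gt_eqF.
elim: k => [_|k IH kn]; first by rewrite mul0r mulr0.
apply: invariant_step (IH (ltnW kn)); first exact: xn (ltnW kn).
rewrite -mulrBr -mulrBl -natrB// subSnn normrM (ger0_norm (divr_ge0 _ _))//.
have : n%:R^-1 <= (1 - t) ^+ 2 / 4 :> R.
  by rewrite -[leRHS]invf_div lef_pV2 ?posrE ?divr_gt0// ltW.
have : `|x| <= 1 by rewrite ler_norml.
have := normr_ge0 x.
rewrite mul1r => X0 X1; set a := n%:R^-1 => an.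
have a0 : 0 < a by rewrite invr_gt0.
have : `|x| * a <= a by rewrite ler_piMl// ltW.
have : `|x| * a * t <= `|x| * a by rewrite ler_piMr ?mulr_ge0// ltW.
by lra.
Qed.

End Invariance.
End BoundedBelow.

(** * Extraction of coefficients *)

Lemma laurent_rec (K : fieldType) (t z : K) n : z != 0 ->
  t * (z + z^-1) * (t ^+ n.+1 * (z ^+ n.+2 - z ^- n.+2)) -
    t ^+ 2 * (t ^+ n * (z ^+ n.+1 - z ^- n.+1)) =
  t ^+ n.+2 * (z ^+ n.+3 - z ^- n.+3).
Proof.
move=> z0; rewrite !exprS; have : z ^+ n != 0 by rewrite expf_neq0.
by move: (z ^+ n) (t ^+ n) => P T P0; field; rewrite z0 P0.
Qed.

(** The algebra of one filtering step, for [a = w ^+ n.+1], [b = w ^+ m], [P = z ^+ n.+1]. *)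
Lemma laurent_average (K : fieldType) (T a b P D1 D2 : K) :
  a != 0 -> b != 0 -> P != 0 -> 2%:R != 0 :> K ->
  2^-1 * (b^-1 * (T * (D1 * (a * P) - D2 * (a * P)^-1)) +
    T * (D1 * P - D2 * P^-1)) =
  T * (D1 * (1 + a / b) / 2 * P - D2 * (1 + (a^-1 / b)) / 2 * P^-1).
Proof. by move=> a0 b0 P0 two0; field; rewrite a0 b0 P0 two0. Qed.

Lemma unit_neq0 (R : realType) (z : R[i]) : normc z = 1 -> z != 0.
Proof.
by apply: contra_eq_neq => ->; rewrite Normc.normc0 eq_sym oner_neq0.
Qed.

Lemma unit_circle_Re (R : realType) (z : R[i]) : normc z = 1 ->
  (complex.Re z *+ 2)%:C = z + z^-1.
Proof.
move=> z1; have z0 := unit_neq0 z1; apply: (mulfI z0).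
rewrite mulrDr divff//; case: z z1 {z0} => a b /= /(congr1 (fun x => x ^+ 2)).
rewrite sqr_sqrtr ?addr_ge0 ?sqr_ge0// expr1n => ab.
by apply/eqP; rewrite eq_complex /=; apply/andP; split; apply/eqP; nra.
Qed.

Section Laurent.
Variables (R : realType) (E : seq_space R) (t : R).
Hypothesis t01 : 0 < t < 1.
Notation X := (seqs_in E).
Notation F := (@shift_space R E).
Implicit Types (z w : R[i]) (Y : X -> Prop).

Lemma closed_subspaceZ Y a x : closed_subspace Y -> Y x -> Y (a *: x).
Proof. by case=> Y0 YD _ Yx; rewrite -[_ *: _]addr0; exact: YD. Qed.

Lemma closed_subspace_deltas Y : closed_subspace Y ->
  (forall k, Y (delta_space E k)) -> forall x, Y x.
Proof.
move=> [Y0 YD Yc] Yd x; apply: Yc => e e0.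
have [|N xN] := (in_spaceE E x).1 (in_space_coords x) (e / 2).
  by rewrite divr_gt0.
exists (\sum_(k < N) x k *: delta_space E k).
  elim: N {xN} => [|N IH]; first by rewrite big_ord0.
  by rewrite big_ord_recr /= addrC; exact: YD.
rewrite -lte_fin -xnormE (_ : coords _ = coords x - trunc N x).
  by apply: le_lt_trans xN _; rewrite lte_fin; lra.
apply/funext => n; rewrite coordB coord_sum; congr (_ - _).
elim: N {xN} => [|N IH]; first by rewrite big_ord0.
by rewrite truncS big_ord_recr /= IH.
Qed.

(** This is the recurrence of [t^n U_n(x)], with [U_n] the Chebyshev polynomials of the second
    kind. *)
Lemma cheb_op_coord_rec x (y : X) : cheb_op F t x y = delta_space E 0 ->
  [/\ y 0%N = 1, y 1%N = (t * x *+ 2)%:C &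
    forall n, y n.+2 = (t * x *+ 2)%:C * y n.+1 - (t ^+ 2)%:C * y n].
Proof.
move=> yE.
have coordE n : delta_space E 0 n = y n - (t * x *+ 2)%:C * F y n +
    (t ^+ 2)%:C * F (F y) n.
  by rewrite -yE /cheb_op /quad_op !coordD coordN !coordZ.
have y0 : y 0%N = 1 by have := coordE 0%N; rewrite /= !mulr0 subr0 addr0 => <-.
split=> //.
  have := coordE 1%N; rewrite /= mulr0 addr0 y0 mulr1 => /esym/eqP.
  by rewrite subr_eq0 => /eqP.
move=> n; have := coordE n.+2; rewrite /= => /esym/eqP.
by rewrite addr_eq0 subr_eq addrC => /eqP.
Qed.

(** The factor [z - z^-1] clears the denominator of [U_n(cos theta) = sin((n+1) theta) / sin theta],
    so [z = 1] and [z = -1] are no exceptions. *)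
Lemma cheb_resolvent_coord z (y : X) : normc z = 1 ->
  cheb_op F t (complex.Re z) y = delta_space E 0 ->
  forall n, (z - z^-1) * y n = (t ^+ n)%:C * (z ^+ n.+1 - z ^- n.+1).
Proof.
move=> z1 /cheb_op_coord_rec[y0 y1 yS].
have z0 := unit_neq0 z1.
have tz : (t * complex.Re z *+ 2)%:C = t%:C * (z + z^-1).
  by rewrite -unit_circle_Re// -mulrnAr rmorphM.
suff H n : (z - z^-1) * y n = (t ^+ n)%:C * (z ^+ n.+1 - z ^- n.+1) /\
    (z - z^-1) * y n.+1 = (t ^+ n.+1)%:C * (z ^+ n.+2 - z ^- n.+2).
  by move=> n; have [] := H n.
elim: n => [|n [IH1 IH2]]; split=> //.
- by rewrite y0 expr0 mul1r mulr1 !expr1.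
- by rewrite y1 tz expr1 !expr2; field.
rewrite yS mulrBr !(mulrCA (z - z^-1)) IH1 IH2 tz !rmorphXn /=.
exact: laurent_rec.
Qed.

Definition div2 (k : nat) (j : int) : R[i] := ((2 ^ k)%:Z %| j)%Z%:R.

(** For [j = q 2^k] the mean is [(1 + (-1)^q) / 2], which selects the even [q]; for other [j] both
    sides vanish. *)
Lemma div2_average k w (j : int) : w ^+ (2 ^ k) = -1 ->
  div2 k j * (1 + w ^ j) / 2 = div2 k.+1 j.
Proof.
move=> wk; have two0 : 2 != 0 :> R[i] by rewrite pnatr_eq0.
rewrite /div2; have [/dvdzP[q ->]|kj] := boolP ((2 ^ k)%:Z %| j)%Z; last first.
  rewrite !mul0r; case: (boolP (_ %| _)%Z) => // k1j; case/negP: kj.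
  by apply: dvdz_trans k1j; rewrite expnS PoszM dvdz_mull.
have -> : w ^ (q * (2 ^ k)%:Z) = (-1) ^ q by rewrite mulrC -exprz_exp -exprnP wk.
rewrite expnS PoszM dvdz_mul2r; last by rewrite eqz_nat -lt0n expn_gt0.
have -> : (-1) ^ q = (-1) ^+ odd `|q|%N :> R[i].
  case: q => n; first by rewrite signr_odd.
  by rewrite NegzE -exprz_inv invrN1 abszN signr_odd.
rewrite mul1r dvdzE dvdn2; case: odd => /=; last by rewrite expr0 divff.
by rewrite expr1 subrr mul0r.
Qed.

Lemma root_of_minus1 k : exists2 w : R[i], normc w = 1 & w ^+ (2 ^ k) = -1.
Proof.
have k0 : (0 < 2 ^ k)%N by rewrite expn_gt0.
have wk : ((2 ^ k).-root (-1 : R[i])) ^+ (2 ^ k) = -1 by exact: rootCK.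
exists ((2 ^ k).-root (-1)) => //; apply/eqP.
rewrite -(pexpr_eq1 k0) ?normc_ge0//; apply/eqP; apply: complexI.
by rewrite rmorphXn /= normcC -normrX wk normrN1.
Qed.

(* The filter at level [k+1] is the mean of the filter at level [k] over
   [z] and [w z] with [w ^+ (2 ^ k) = -1], weighted by [1] and [w ^- m]. *)
Lemma dyadic_filter Y (m : nat) : closed_subspace Y ->
  (forall z, normc z = 1 -> exists2 y : X, Y y &
    forall n, y n = (t ^+ n)%:C * (z ^+ n.+1 - z ^- n.+1)) ->
  forall k z, normc z = 1 -> exists2 y : X, Y y &
    forall n, y n = (t ^+ n)%:C * (div2 k (n.+1%:Z - m%:Z) * z ^+ n.+1 -
      div2 k (n.+1%:Z + m%:Z) * z ^- n.+1).
Proof.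
move=> Ycl H; have [Y0 YD _] := Ycl; elim=> [|k IH] z z1.
  have [y Yy yE] := H z z1; exists y => // n.
  by rewrite yE /div2 expn0 !dvd1z !mul1r.
have [w w1 wk] := root_of_minus1 k.
have w0 := unit_neq0 w1.
have z0 := unit_neq0 z1.
have [y1 Yy1 y1E] := IH z z1.
have [|y2 Yy2 y2E] := IH (w * z); first by rewrite Normc.normcM w1 z1 mulr1.
exists (2^-1 *: (w ^- m *: y2 + y1)).
  by apply: closed_subspaceZ => //; exact: YD.
have two0 : 2%:R != 0 :> R[i] by rewrite pnatr_eq0.
(* The negative powers of [z] collect [w^-1] to the power [n + 1 + m], so the averaging is also
   needed for [w^-1]. *)
have wVk : w^-1 ^+ (2 ^ k) = -1 by rewrite exprVn wk invrN1.
move=> n; rewrite coordZ coordD coordZ y1E y2E.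
rewrite -(div2_average _ wk) -(div2_average _ wVk).
rewrite !expfzDr ?invr_neq0// -!exprnP -exprnN !exprVn !exprMn.
by rewrite -laurent_average ?expf_neq0// -exprnP.
Qed.

(** In every space considered, the norm of a truncation is at most the sum of its moduli. *)
Lemma rnorm_le_geometric_tail N (x : X) :
  (forall n, (n < N)%N -> x n = 0) -> (forall n, normc (x n) <= t ^+ n) ->
  rnorm x <= t ^+ N / (1 - t).
Proof.
move=> x0 xt; have [t0 t1] := andP t01.
have tt : 0 <= t < 1 by rewrite ltW.
have b0 : 0 <= t ^+ N / (1 - t).
  by rewrite divr_ge0 ?exprn_ge0 ?subr_ge0 ?(ltW t0) ?(ltW t1).
rewrite -lee_fin -xnormE; apply: xnorm_trunc_le => // M.
apply: le_trans (xnorm_trunc_sum _ _ _) _; rewrite lee_fin.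
have z0 K : (K <= N)%N -> \sum_(n < K) normc (x n) = 0.
  move=> KN; rewrite big1// => n _; rewrite x0 ?Normc.normc0//.
  exact: leq_trans (ltn_ord n) KN.
have [MN|/ltnW NM] := leqP M N; first by rewrite z0.
rewrite -(big_mkord xpredT (fun n => normc (x n))) (@big_cat_nat _ _ _ N)//=.
rewrite big_mkord z0// add0r.
have := geometric_tail_le N M (@ler01 R) tt; rewrite mul1r; apply: le_trans.
by apply: ler_sum => n _; rewrite mul1r.
Qed.

Lemma deltas_of_laurent Y : closed_subspace Y ->
  (forall z, normc z = 1 -> exists2 y : X, Y y &
    forall n, y n = (t ^+ n)%:C * (z ^+ n.+1 - z ^- n.+1)) ->
  forall k, Y (delta_space E k).
Proof.
move=> Ycl H k; have [t0 t1] := andP t01; have [Y0 YD Yc] := Ycl.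
have tt : 0 <= t < 1 by rewrite ltW.
have tk0 : (t ^+ k)%:C != 0 by rewrite rmorphXn expf_neq0// fmorph_eq0 gt_eqF.
suff : Y ((t ^+ k)%:C *: delta_space E k).
  move=> /(closed_subspaceZ (t ^+ k)%:C^-1 Ycl).
  by rewrite scalerA mulVf// scale1r.
apply: Yc => e e0; have [N HN] := exprn_mul_lt_eps (1 - t)^-1 tt e0.
(* For [n < N0], both [|n - k|] and [n + k + 2] are less than [2 ^ K], so divisibility by [2 ^ K]
   means vanishing and only [n = k] survives. *)
pose K := (N + k + k).+3; have := ltn_expl K (ltnSn 1); set Q := (2 ^ K)%N => KQ.
(* The filter is centred at [k.+1] because coordinate [n] carries [z ^+ n.+1]; then [z = 1]. *)
have [y Yy yE] := dyadic_filter k.+1 Ycl H K (Normc.normc1 R).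
exists y => //; pose N0 := (N + k).+1.
apply: (@le_lt_trans _ _ (t ^+ N0 / (1 - t))); last first.
  by rewrite mulrC HN// /N0; lia.
have div2_lt (j : int) : (`|j| < Q)%N -> div2 K j = (j == 0)%:R.
  move=> jQ; rewrite /div2 dvdzE /= -/Q; congr (_%:R).
  have [->|j0] := eqVneq j 0; first by rewrite dvdn0.
  by rewrite gtnNdvd// absz_gt0.
have low n : (n < N0)%N ->
    ((t ^+ k)%:C *: delta_space E k - y) n = 0.
  move=> nN; rewrite coordB coordZ yE !expr1n invr1 !mulr1.
  rewrite !div2_lt; [|by rewrite /K /N0 in KQ nN; lia..].
  rewrite [delta_space E k n]/= /delta.
  rewrite (_ : (n.+1%:Z + k.+1%:Z == 0) = false) ?subr0; last lia.
  rewrite (_ : (n.+1%:Z - k.+1%:Z == 0) = (n == k)); last lia.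
  by case: eqP => [->|_]; rewrite ?mulr0 ?subrr.
apply: rnorm_le_geometric_tail => // n.
have [/low ->|Nn] := ltnP n N0; first by rewrite Normc.normc0 exprn_ge0 ?(ltW t0).
rewrite coordB coordZ yE !expr1n invr1 !mulr1 [delta_space E k n]/= /delta.
rewrite gtn_eqF ?mulr0 ?sub0r ?normcN; last by rewrite /N0 in Nn; lia.
rewrite Normc.normcM normc_complexR ger0_norm ?exprn_ge0 ?(ltW t0)//.
rewrite ler_piMr ?exprn_ge0 ?(ltW t0)// /div2.
do 2!case: (_ %| _)%Z; rewrite ?mulr1n ?mulr0n ?subrr ?subr0 ?sub0r.
all: by rewrite ?normcN ?Normc.normc0 ?Normc.normc1.
Qed.

Lemma cheb_invariant_full Y : closed_subspace Y ->
  invariant_at F Y t (delta_space E 0) 0 -> forall x, Y x.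
Proof.
move=> Ycl I0; apply: closed_subspace_deltas => //.
apply: deltas_of_laurent => // z z1.
have xz : -1 <= complex.Re z <= 1.
  by rewrite -ler_norml -z1 Re_le_normc.
have complX := @space_geometric_complete R E.
have F1 := @shift_space_bounded R E.
have [A [AK _ _]] := cheb_op_inverse complX F1 t01 xz.
have [_ Yv] := invariant_chain complX F1 Ycl t01 I0 xz.
exists ((z - z^-1) *: A (delta_space E 0)).
  by apply: closed_subspaceZ => //; apply: Yv; rewrite AK.
by move=> n; rewrite coordZ; apply: cheb_resolvent_coord; rewrite ?AK.
Qed.

End Laurent.

(** * Closures of subspaces *)

Section NormClosure.
Variables (R : realType) (X : normedModType R[i]).
Implicit Types (G : X -> Prop) (x y : X).

Definition norm_closure G x : Prop :=
  forall e : R, 0 < e -> exists2 y, G y & rnorm (x - y) < e.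

Lemma sub_norm_closure G x : G x -> norm_closure G x.
Proof. by move=> Gx e e0; exists x => //; rewrite subrr rnorm0. Qed.

Lemma norm_closure_image G (K : {linear X -> X}) M x : 0 <= M ->
  rbounded M K -> (forall y, G y -> G (K y)) ->
  norm_closure G x -> norm_closure G (K x).
Proof.
move=> M0 KM KG Gx e e0; have M1 : 0 < M + 1 by rewrite ltr_wpDl.
have [|y Gy xy] := Gx (e / (M + 1)); first by rewrite divr_gt0.
exists (K y); first exact: KG.
rewrite -linearB (le_lt_trans (KM _))//.
apply: (@le_lt_trans _ _ ((M + 1) * rnorm (x - y))).
  by rewrite ler_wpM2r ?rnorm_ge0// lerDl.
by rewrite mulrC -ltr_pdivlMr.
Qed.

Lemma closed_subspace_closure G :
  G 0 -> (forall a x y, G x -> G y -> G (a *: x + y)) ->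
  closed_subspace (norm_closure G).
Proof.
move=> G0 GD; split=> [|a x y Gx Gy e e0|x Gx e e0].
- exact: sub_norm_closure.
- have a1 : 0 < normc a + 1 by rewrite ltr_wpDl ?normc_ge0.
  have [|x' Gx' xx'] := Gx (e / 2 / (normc a + 1)); first by rewrite !divr_gt0.
  have [|y' Gy' yy'] := Gy (e / 2); first by rewrite divr_gt0.
  exists (a *: x' + y'); first exact: GD.
  rewrite opprD addrACA -scalerBr (le_lt_trans (rnormD _ _))//.
  rewrite [e]splitr ler_ltD// rnormZ.
  apply: (@le_trans _ _ ((normc a + 1) * rnorm (x - x'))).
    by rewrite ler_wpM2r ?rnorm_ge0// lerDl.
  by rewrite mulrC -ler_pdivlMr// ltW.
- have e2 : 0 < e / 2 by rewrite divr_gt0.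
  have [y yG xy] := Gx _ e2; have [z Gz yz] := yG _ e2.
  exists z => //; rewrite (le_lt_trans (rdist_triangle y _ _))//.
  by rewrite [e]splitr ltrD.
Qed.

Lemma closed_subspace_preimage (Y : X -> Prop) (K : {linear X -> X}) M :
  0 <= M -> rbounded M K -> closed_subspace Y ->
  closed_subspace (fun x => Y (K x)).
Proof.
move=> M0 KM [Y0 YD Yc]; split=> [|a x y Yx Yy|x xY].
- by rewrite linear0.
- by rewrite linearP; exact: YD.
- apply: Yc => e e0; have M1 : 0 < M + 1 by rewrite ltr_wpDl.
  have [|y Yy xy] := xY (e / (M + 1)); first by rewrite divr_gt0.
  exists (K y) => //; rewrite -linearB (le_lt_trans (KM _))//.
  apply: (@le_lt_trans _ _ ((M + 1) * rnorm (x - y))).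
    by rewrite ler_wpM2r ?rnorm_ge0// lerDl.
  by rewrite mulrC -ltr_pdivlMr.
Qed.

(** For each pair [(i, j)] a point of [G] is chosen within [1 / (j + 1)] of [d i], and the pairs are
    enumerated. *)
Lemma dense_sequence_in G (d : nat -> X) :
  (forall x (e : R), 0 < e -> exists k, rnorm (x - d k) < e) ->
  (forall x, norm_closure G x) ->
  exists y : nat -> X, (forall k, G (y k)) /\
    forall x (e : R), 0 < e -> exists k, rnorm (x - y k) < e.
Proof.
move=> dd Gd.
have inv0 n : 0 < (n.+1%:R : R)^-1 by rewrite invr_gt0.
have /choice[f fP] (a : nat * nat) : exists y, G y /\
    rnorm (d a.1 - y) < a.2.+1%:R^-1.
  by have [y Gy dy] := Gd (d a.1) _ (inv0 a.2); exists y.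
pose dec k := odflt (0, 0)%N (unpickle k : option (nat * nat)).
exists (fun k => f (dec k)); split=> [k|x e e0]; first by have [] := fP (dec k).
have e2 : 0 < e / 2 by rewrite divr_gt0.
have [i xi] := dd x _ e2; pose j := Num.truncn (e / 2)^-1.
exists (pickle (i, j)); rewrite /dec pickleK /=.
rewrite (le_lt_trans (rdist_triangle (d i) _ _))// [e]splitr ltrD//.
have [_ /lt_le_trans -> //] := fP (i, j).
by rewrite -[leRHS]invrK lef_pV2 ?posrE ?invr_gt0//= ltW// truncnS_gt.
Qed.

End NormClosure.

Lemma linear_subZ (K : pzRingType) (X Y : lmodType K) (f : {linear X -> Y})
  a x y : f (x - a *: y) = f x - a *: f y.
Proof. by rewrite linearB linearZ. Qed.

(** * The transition operator of the walk *)

Section Walk.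
Variables (R : realType) (E : seq_space R) (p : R).
Notation X := (seqs_in E).
Notation F := (@shift_space R E).
Notation B := (@backshift_space R E).
Implicit Types x y : X.

(** The multiple of [delta_space E 0] accounts for [W_{0,0} = 1 - p], the walk staying at 0. *)
Definition walk_op x : X :=
  p%:C *: B x + (1 - p)%:C *: (F x + x 0%N *: delta_space E 0).

Lemma walk_op_is_linear : linear walk_op.
Proof.
move=> a x y; apply: coordsI => n; rewrite /walk_op.
rewrite coordD coordZ !coordD !coordZ !coordD !linearP !coordD !coordZ.
rewrite !coordD !coordZ; ring.
Qed.

HB.instance Definition _ := GRing.isLinear.Build R[i] X X *:%R
  walk_op walk_op_is_linear.

Lemma walk_op0 x : walk_op x 0%N = (1 - p)%:C * x 0%N + p%:C * x 1%N.
Proof.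
rewrite /walk_op !(coordD, coordZ) /= /backshift /delta eqxx mulr1 add0r.
exact: addrC.
Qed.

Lemma walk_opS x n : walk_op x n.+1 = (1 - p)%:C * x n + p%:C * x n.+2.
Proof.
rewrite /walk_op !(coordD, coordZ) /= /backshift /delta /= mulr0 addr0.
exact: addrC.
Qed.

Lemma walk_op_bounded : rbounded (`|p| + `|1 - p| * 2) walk_op.
Proof.
move=> x; rewrite /walk_op mulrDl -mulrA.
apply: le_trans (rnormD _ _) _; rewrite !rnormZ !normc_complexR.
have := backshift_space_bounded x; have := shift_space_bounded x.
rewrite !mul1r => Fx Bx; apply: lerD; first by rewrite ler_wpM2l.
rewrite ler_wpM2l// (le_trans (rnormD _ _))// mulrDl mul1r lerD// rnormZ.
rewrite -[leRHS]mulr1 ler_pM ?normc_ge0 ?rnorm_ge0 ?normc_coord//.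
exact: rnorm_delta_space.
Qed.

Lemma walk_op_acts : acts_as_matrix walk_op (walk_matrix p).
Proof.
have pick (c : nat -> R[i]) k N : (k < N)%N ->
    \sum_(0 <= j < N) (if j == k then c j else 0) = c k.
  by move=> kN; rewrite -big_mkcond big_nat1_eq kN.
move=> x i.
(* A row has at most two nonzero entries, in columns below [i.+3], so the partial sums are
   eventually constant. *)
suff H N : \sum_(0 <= j < (N + i.+3)%N) (walk_matrix p i j)%:C * x j = walk_op x i.
  rewrite -(cvg_shiftn i.+3) (_ : (fun N => _) = cst (walk_op x i)).
    exact: cvg_cst.
  by apply/funext => N; exact: H.
case: i => [|i]; rewrite ?walk_op0 ?walk_opS.
  rewrite (eq_bigr (fun j => (if j == 0%N then (1 - p)%:C * x j else 0) +
     (if j == 1%N then p%:C * x j else 0))).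
    by rewrite big_split !pick//; lia.
  move=> j _; rewrite /walk_matrix; case: j => [|[|j]] /=; rewrite ?addr0 ?add0r//.
  by rewrite mul0r.
rewrite (eq_bigr (fun j => (if j == i then (1 - p)%:C * x j else 0) +
     (if j == i.+2 then p%:C * x j else 0))).
  by rewrite big_split !pick//; lia.
move=> j _; rewrite /walk_matrix; case: eqP => [->|_].
  by rewrite ltn_eqF ?addr0.
by case: eqP => _; rewrite add0r // mul0r.
Qed.

Hypotheses (p01 : 0 < p < 1) (p_gt_half : 1 / 2 < p).

Let r := (1 - p) / p.
Let p0 : 0 < p. Proof. by case/andP: p01. Qed.
Let r0 : 0 < r. Proof. by rewrite divr_gt0// subr_gt0; case/andP: p01. Qed.
Let r1 : r < 1.
Proof. by rewrite /r ltr_pdivrMr// mul1r; have := p_gt_half; lra. Qed.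
Let pr : p * r = 1 - p.
Proof. by rewrite /r mulrC divfK// gt_eqF. Qed.

(** Bounding [1 + r F^2] below as a whole, instead of factor by factor, gives the constant [1 - r];
    then [p (1 - r) = 2 p - 1] produces the threshold of the theorem. *)
Lemma walk_resolvent : exists A : {linear X -> X},
  [/\ cancel A (quad_op F 0 r%:C), cancel (quad_op F 0 r%:C) A &
    rbounded (1 - r)^-1 A].
Proof.
have F1 := @shift_space_bounded R E.
pose L : {linear X -> X} := (- r%:C) \*: (F \o F).
have Lb : rbounded r L.
  move=> x; rewrite /= rnormZ normcN normc_complexR gtr0_norm// ler_wpM2l ?(ltW r0)//.
  have := F1 (F x); have := F1 x; rewrite !mul1r => Fx FFx.
  exact: le_trans FFx Fx.
have PL x : quad_op F 0 r%:C x = x - L x.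
  by rewrite /quad_op scale0r subr0 /= scaleNr opprK.
apply: (bounded_below_inverse (P := quad_op F 0 r%:C)); first by rewrite subr_gt0.
- move=> x; apply: (@le_trans _ _ (rnorm (x - L x))); last by rewrite -PL.
  rewrite mulrBl mul1r lerBlDr -{1}[x](subrK (L x)) (le_trans (rnormD _ _))// lerD2l.
  exact: Lb.
- move=> x; have [|y yx] := neumann (@space_geometric_complete R E) x _ Lb.
    by rewrite (ltW r0).
  by exists y; rewrite -yx; exact: PL.
Qed.

Lemma walk_right_inverse : exists S : {linear X -> X},
  [/\ cancel S walk_op, rbounded (2 * p - 1)^-1 S &
    forall x, norm_closure (fun y => exists n, iter n walk_op y = 0) x].
Proof.
have F1 := @shift_space_bounded R E.
have [A [AK PK Ab]] := walk_resolvent.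
pose S : {linear X -> X} := p^-1%:C \*: (F \o A).
have PE x : forall n, x n = A x n + r%:C * F (F (A x)) n.
  by move=> n; rewrite -{1}[x]AK /quad_op scale0r subr0 coordD coordZ.
have pC0 : p%:C != 0 by rewrite fmorph_eq0 gt_eqF.
have SE x n : S x n = p^-1%:C * F (A x) n by [].
have pVC : p%:C * p^-1%:C = 1 :> R[i] by rewrite -rmorphM divff ?gt_eqF.
have SK : cancel S walk_op.
  move=> x; apply: coordsI => -[|n]; rewrite ?walk_op0 ?walk_opS.
    rewrite (SE x 1%N) (SE x 0%N) (PE x 0%N) [p%:C * _]mulrA pVC mul1r.
    by rewrite [F (A x) 0%N]/= [F _ 0%N]/= !mulr0 add0r addr0.
  rewrite (SE x n) (SE x n.+2) (PE x n.+1) [p%:C * _]mulrA pVC mul1r mulrA.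
  rewrite -rmorphM -/r addrC.
  by case: n.
have Sb : rbounded (2 * p - 1)^-1 S.
  move=> x; rewrite /= rnormZ normc_complexR gtr0_norm ?invr_gt0//.
  have := F1 (A x); rewrite mul1r => /le_trans /(_ (Ab x)).
  move=> /(ler_wpM2l (ltW (_ : 0 < p^-1))) /le_trans; apply.
    by rewrite invr_gt0.
  by rewrite mulrA -invfM mulrBr mulr1 pr opprB addrA -mulr2n mulr_natl.
exists S; split=> //.
set G := fun y => exists n, iter n walk_op y = 0.
have GD a x y : G x -> G y -> G (a *: x + y).
  move=> [m xm] [n yn]; exists (m + n)%N; rewrite linearP /=.
  by rewrite addnC iterD xm linear0 scaler0 add0r addnC iterD yn linear0.
have G0 : G 0 by exists 0%N.
have clG := closed_subspace_closure G0 GD.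
(* [D = 1 - r F] is the numerator of the eigenvectors. The Chebyshev argument runs on the preimage
   under [D] of the closure of [G]; since [D] is onto, filling that preimage suffices. *)
pose D : {linear X -> X} := quad_op F r%:C 0.
have DE x : D x = x - r%:C *: F x by rewrite /D /= /quad_op scale0r addr0.
have Db : rbounded (1 + r) D.
  move=> x; rewrite DE (le_trans (rnormB _ _))// mulrDl mul1r lerD2l rnormZ.
  rewrite normc_complexR gtr0_norm// ler_wpM2l ?(ltW r0)//.
  by have := F1 x; rewrite mul1r.
have r01 : 0 <= 1 + r by rewrite addr_ge0 ?(ltW r0).
have clY := closed_subspace_preimage r01 Db clG.
have AF y : A (F y) = F (A y).
  by apply: (inverse_commute _ AK PK) => z; exact: quad_opC.
have t01 : 0 < Num.sqrt r < 1.
  by rewrite sqrtr_gt0 r0 -[ltRHS]sqrtr1 ltr_sqrt.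
(* For [t = sqrt r], the operator [1 + r F^2] is the Chebyshev operator at [x = 0], where the
   propagation starts. *)
have chE x : cheb_op F (Num.sqrt r) 0 x = quad_op F 0 r%:C x.
  by rewrite /cheb_op mulr0 mul0rn sqr_sqrtr// ltW.
suff clD x : norm_closure G (D x).
  move=> x; have [|y <-] := @one_sub_surj _ _ (@space_geometric_complete R E) _
    F1 r%:C x; first by rewrite normc_complexR gtr0_norm.
  by rewrite -DE.
apply: (cheb_invariant_full t01 clY); split=> y.
  rewrite chE => Gy.
  (* [S] is built from [F] and [A], which commute with [D]. It preserves [G] because [W S = 1]
     raises the nilpotency order by one. *)
  have -> : D (F y) = p%:C *: S (D (quad_op F 0 r%:C y)).
    have AD : A (D (quad_op F 0 r%:C y)) = D y.
      by rewrite !DE linear_subZ AF PK.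
    have -> u : S u = p^-1%:C *: F (A u) by [].
    by rewrite AD scalerA pVC scale1r !DE linear_subZ.

  apply: (closed_subspaceZ p%:C clG).
  apply: (norm_closure_image _ Sb _ Gy).
    by rewrite invr_ge0; have := p_gt_half; lra.
  by move=> z [n zn]; exists n.+1; rewrite iterSr SK.
(* Here [y = (1, 0, -r, 0, r^2, ...)], and [D y] is the eigenvector for the eigenvalue 0: one
   application of [walk_op] kills it. *)
rewrite chE => yE; apply: sub_norm_closure; exists 1%N.
have coordE n : delta_space E 0 n = y n + r%:C * F (F y) n.
  by rewrite -yE /quad_op scale0r subr0 coordD coordZ.
have y0 : y 0%N = 1 by have := coordE 0%N; rewrite /= mulr0 addr0 => <-.
have y1 : y 1%N = 0 by have := coordE 1%N; rewrite /= mulr0 addr0 => <-.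
have yS n : y n.+2 = - (r%:C * y n).
  by have /esym/eqP := coordE n.+2; rewrite addr_eq0 => /eqP.
have uE n : D y n = y n - r%:C * F y n by rewrite DE coordB coordZ.
have pqE : (1 - p)%:C = p%:C * r%:C :> R[i] by rewrite -pr rmorphM.
rewrite [LHS]/=; apply: coordsI => -[|n]; rewrite ?walk_op0 ?walk_opS pqE !uE.
  by rewrite [F y _]/= [F y _]/= y0 y1 mulr0 subr0 sub0r !mulr1 mulrN subrr.
rewrite (_ : y n.+2 - r%:C * F y n.+2 = - (r%:C * (y n - r%:C * F y n))).
  by rewrite mulrN mulrA subrr.
rewrite [F y n.+2]/= yS; case: n => [|n].
  by rewrite [F y 0%N]/= y1 !mulr0 !subr0.
by rewrite yS [F y n.+1]/= mulrBr opprB mulrN opprK addrC.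
Qed.

End Walk.

(** * Multiples of the walk operator and conclusion *)

Lemma iter_scale (R : realType) (X : lmodType R[i]) (T : {linear X -> X})
  (a : R[i]) n x : iter n (a \*: T) x = a ^+ n *: iter n T x.
Proof.
elim: n => [|n IH]; first by rewrite expr0 scale1r.
by rewrite !iterS IH [LHS]/= linearZ scalerA exprS.
Qed.

Theorem theorem4p1 (R : realType) (X : seq_space R) (p : R)
    (p01 : 0 < p < 1) (p_gt_half : 1 / 2 < p) :
  exists W : {linear seqs_in X -> seqs_in X},
    [/\ bounded_operator W,
        acts_as_matrix W (walk_matrix p),
        supercyclic W
      & forall lambda : R[i], (1 / (2 * p - 1))%:C < `|lambda| ->
          frequently_hypercyclic (lambda \*: W) /\
          devaney_chaotic (lambda \*: W)].
Proof.
pose W : {linear seqs_in X -> seqs_in X} := @walk_op R X p.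
have [S [SK Sb Wnil]] := @walk_right_inverse R X p p01 p_gt_half.
have [d dd] := space_separable X.
have [y [ynil yd]] := dense_sequence_in dd Wnil.
have c0 : 0 < 2 * p - 1 by lra.
have Wb := @walk_op_bounded R X p.
set M := `|p| + `|1 - p| * 2 in Wb.
have M0 : 0 <= M by rewrite addr_ge0 ?mulr_ge0.
have complX := @space_geometric_complete R X.
have delta0 : delta_space X 0 != 0.
  apply/eqP => /(congr1 (fun x : seqs_in X => x 0%N)) /eqP.
  by rewrite coords0 /= /delta eqxx oner_eq0.
have main (lambda : R[i]) : (1 / (2 * p - 1))%:C < `|lambda| ->
    [/\ frequently_hypercyclic (lambda \*: W), hypercyclic (lambda \*: W),
     dense (periodic_points (lambda \*: W)) & sensitive (lambda \*: W)].
  rewrite -normcC ltcR div1r => ltl.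
  have l0 : 0 < normc lambda by apply: lt_trans ltl; rewrite invr_gt0.
  have lambda0 : lambda != 0.
    by apply: contraTneq l0 => ->; rewrite Normc.normc0 ltxx.
  pose T : {linear seqs_in X -> seqs_in X} := lambda \*: W.
  pose S' : {linear seqs_in X -> seqs_in X} := lambda^-1 \*: S.
  pose sigma := (normc lambda)^-1 * (2 * p - 1)^-1.
  have sigma01 : 0 <= sigma < 1.
    rewrite mulr_ge0 ?invr_ge0 ?ltW//= /sigma mulrC ltr_pdivrMr// mul1r.
    exact: ltl.
  have Tb : rbounded (normc lambda * M) T.
    by move=> x; rewrite [T x]/= rnormZ -mulrA ler_wpM2l ?(ltW l0).
  have S'b : rbounded sigma S'.
    move=> x; rewrite [S' x]/= rnormZ Normc.normcV -mulrA ler_wpM2l//.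
    by rewrite invr_ge0 ltW.
  have S'K : cancel S' T.
    move=> x; have -> : T (S' x) = lambda *: W (lambda^-1 *: S x) by [].
    rewrite (_ : W _ = lambda^-1 *: W (S x)); last by rewrite linearZ.
    by rewrite scalerA divff// scale1r; exact: SK.
  have ynilT k : exists n, iter n T (y k) = 0.
    by have [n yn] := ynil k; exists n; rewrite iter_scale yn scaler0.
  have TM0 : 0 <= normc lambda * M by rewrite mulr_ge0 ?(ltW l0).
  split.
  - exact: (frequently_hypercyclic_of_right_inverse
      complX TM0 sigma01 Tb S'b S'K yd ynilT).
  - exact: (hypercyclic_of_right_inverse
      complX TM0 sigma01 Tb S'b S'K yd ynilT).
  - exact: (periodic_dense_of_right_inverse
      complX TM0 sigma01 Tb S'b S'K yd ynilT).
  - exact: (sensitive_of_right_inverse sigma01 S'b S'K delta0).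
exists W; split.
- exists M => x; rewrite -!rnormE -rmorphM lecR; exact: Wb.
- exact: walk_op_acts.
(* Any [l] beyond the threshold makes [l W] hypercyclic, and its orbits consist of multiples
   [l^n W^n x], whence supercyclicity of [W]. *)
- pose l : R[i] := ((2 * p - 1)^-1 + 1)%:C.
  have [|_ [x xd] _ _] := main l.
    rewrite -normcC ltcR normc_complexR div1r ger0_norm ?ltrDl//.
    by rewrite ltW// addr_gt0 ?invr_gt0.
  exists x => V V0 oV; have [z [Vz [n _ zn]]] := xd V V0 oV.
  exists z; split=> //; exists (l ^+ n), n; rewrite -zn.
  exact: iter_scale.
- by move=> lambda /main[fh h pd s]; split.
Qed.
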